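(* Let $R$ be a prime ring which is an algebra over a commutative subring $A$ contained in the center of $R$, such that $R$ is a finitely generated $A$-module, $A$ is integrally closed, and the fraction field $F$ of $A$ has characteristic $0$. Then the reduced trace $t_{S/F}$ of $S=R\otimes_AF$ maps $R$ into $A$; and $R$ with the induced trace $t_{R/A}$ (as well as $S$ with $t_{S/F}$) is an $n$-Cayley–Hamilton algebra with $n=[S:F]=:[R:A]$.
   Context: Since $R$ is prime and finite over $A$, $A$ is a domain, $R$ is torsion free, and $S=R\otimes_AF$ is a finite-dimensional simple algebra, $S\cong M_k(D)$ with $D$ a division ring with center $Z$, $\dim_ZD=h^2$, $p=[Z:F]$. The degree is $[S:F]:=hkp$. The reduced trace is $t_{S/F}(a):=\frac{1}{hk}\operatorname{tr}_F(L_a)$, where $L_a:S\to S$ is left multiplication by $a$ (equivalently, the sum of the matrix traces of the $p$ components of $a\otimes1\in S\otimes_F\overline Z\cong M_{hk}(\overline Z)^{\oplus p}$). An algebra with trace over $A$ is an associative unital algebra with an $A$-linear map $t$ satisfying $t(a)b=bt(a)$, $t(ab)=t(ba)$, $t(t(a)b)=t(a)t(b)$; it is $n$-Cayley–Hamilton if $t(1)=n$ and $\chi^n_a(a)=0$ for all $a$, where $\chi^n_a(x)=x^n+\sum_{i=1}^nP_i(t(a),\dots,t(a^i))x^{n-i}$ with $P_i$ the universal rational polynomials expressing elementary symmetric functions in terms of power sums. *)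

(* Defs.v *)
From HB Require Import structures.
From mathcomp Require Import all_boot all_order all_algebra all_field.
Set Implicit Arguments.
Unset Strict Implicit.
Unset Printing Implicit Defensive.
Import GRing.Theory.
Local Open Scope ring_scope.

Notation tofrac := (@FracField.tofrac _).
Notation "x %:F" := (@FracField.tofrac _ x) : ring_scope.

Definition prime_ring (R : pzRingType) : Prop :=
  (1 != 0 :> R) /\
  forall x y : R, (forall r : R, x * r * y = 0) -> x = 0 \/ y = 0.

Definition integrally_closed (A : idomainType) : Prop :=
  forall x : {fraction A},
    (exists p : {poly A}, p \is monic /\ root (map_poly tofrac p) x) ->
    exists a : A, x = a%:F.

Definition fin_gen_module (A : comPzRingType) (R : lmodType A) : Prop :=
  exists s : seq R, forall r : R,
    exists c : 'I_(size s) -> A, r = \sum_(i < size s) c i *: s`_i.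

(* iota : R -> S exhibits S as R (x)_A F, F = Frac A, for R torsion free:
   iota is an injective A-linear ring map and S = { iota r / a | a <> 0 }. *)
Definition scalar_extension (A : idomainType) (R : algType A)
    (S : falgType {fraction A}) (iota : {rmorphism R -> S}) : Prop :=
  [/\ forall (a : A) (r : R), iota (a *: r) = a%:F *: iota r,
      injective iota &
      forall x : S, exists (r : R) (a : A), a != 0 /\ x = (a%:F)^-1 *: iota r].

Definition lfun_trace (K : fieldType) (V : vectType K) (f : 'End(V)) : K :=
  \tr (passmx.mxof (vbasis fullv) (vbasis fullv) f).

(* For S = M_k(D), Z = center, dim_Z D = h^2 : hk = sqrt(dim_Z S)
   = sqrt(dim_F S / dim_F Z). *)
Definition deg_center (K : fieldType) (S : falgType K) : nat :=
  Nat.sqrt (\dim {:S} %/ \dim 'Z({:S})%VS)%N.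

(* degree [S:F] = hkp, p = [Z:F] *)
Definition rdegree (K : fieldType) (S : falgType K) : nat :=
  (deg_center S * \dim 'Z({:S})%VS)%N.

Definition reduced_trace (K : fieldType) (S : falgType K) (a : S) : K :=
  (deg_center S)%:R^-1 * lfun_trace (amull a).

Definition trace_alg (B : comPzRingType) (T : algType B) (t : T -> B) : Prop :=
  [/\ forall (b : B) (x y : T), t (b *: x + y) = b * t x + t y,
      forall a b : T, (t a)%:A * b = b * (t a)%:A,
      forall a b : T, t (a * b) = t (b * a) &
      forall a b : T, t ((t a)%:A * b) = t a * t b].

(* Coefficients c_0 = 1, c_1, ..., c_m of x^m + c_1 x^(m-1) + ... + c_m
   as the universal rational expressions P_i in the power sums p_1..p_m
   (Newton's identities  i c_i = - sum_{j=1}^i c_{i-j} p_j ). *)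
Fixpoint ncoefs (K : fieldType) (p : nat -> K) (m : nat) : seq K :=
  if m is m'.+1 then
    let s := ncoefs p m' in
    rcons s (- (m'.+1%:R)^-1 * \sum_(j < m'.+1) s`_(m' - j) * p j.+1)
  else [:: 1].

(* chi^n_a(a) = 0 for all a; the coefficients P_i(t(a),...,t(a^i)) are
   computed in a characteristic 0 field K receiving the trace values via phi,
   and are required to come from B. *)
Definition CH_identity (B : comPzRingType) (K : fieldType) (phi : B -> K)
    (T : algType B) (t : T -> B) (n : nat) : Prop :=
  forall a : T, exists c : nat -> B,
    (forall i, (0 < i <= n)%N ->
       phi (c i) = (ncoefs (fun j => phi (t (a ^+ j))) n)`_i) /\
    a ^+ n + \sum_(i < n) c i.+1 *: a ^+ (n - i.+1) = 0.

Definition n_CH_algebra (B : comPzRingType) (K : fieldType) (phi : B -> K)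
    (T : algType B) (t : T -> B) (n : nat) : Prop :=
  [/\ trace_alg t, t 1 = n%:R & CH_identity phi t n].

(* Main.v *)
Require Import Defs.
From HB Require Import structures.
From mathcomp Require Import all_boot all_order all_algebra all_field.
From mathcomp Require Import zify ring.
From Stdlib Require Import Classical.

Set Implicit Arguments.
Unset Strict Implicit.
Unset Printing Implicit Defensive.

Import GRing.Theory.
Local Open Scope ring_scope.

(** After a suitable extension K of F, the algebra S is split: choose an
    extension K and a decomposition of 1 into orthogonal idempotents e_i of
    the K-span T of the regular representation of S, with as many idempotents
    as possible over all K.  By maximality (Fitting's lemma over a further
    extension containing an eigenvalue) and nondegeneracy of the trace form,
    e_i T e_i = K e_i, which gives matrix units, hence a faithful
    representation rho of S whose trace is proportional to the regular trace.

    That all blocks of T have the same size d comes from the central element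
    W = sum_l z_l w_l of S built from a basis of the center and its dual basis
    for the trace form: W e_i = (tr e_i)^-2 e_i, and since nonzero central
    elements of a prime algebra are invertible, W is the scalar (tr e_i)^-2
    for each i.  Taking traces, dim S = d^2 p, so rho has degree dp and trace
    the reduced trace.

    Newton's identities then identify the Cayley-Hamilton polynomial of a with
    the characteristic polynomial of rho a.  Elements of R are integral over
    A, hence so are the eigenvalues of rho r and the coefficients of its
    characteristic polynomial; these lie in F, so in A. *)

(** * Newton's identities for characteristic polynomials *)

Lemma deriv_prod_seq (R : comNzRingType) (I : eqType) (s : seq I)
    (f : I -> {poly R}) : uniq s ->
  (\prod_(j <- s) f j)^`() =
    \sum_(i <- s) \prod_(j <- s) (if j == i then (f j)^`() else f j).
Proof.
elim: s => [|x s IHs] /=; first by rewrite !big_nil derivE.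
case/andP=> xs us; rewrite !big_cons derivM IHs // eqxx; congr (_ * _ + _).
  by apply: eq_big_seq => j js; case: eqP js xs => // -> ->.
rewrite mulr_sumr; apply: eq_big_seq => i iss; rewrite big_cons.
by case: eqP iss xs => // -> ->.
Qed.

(** By multilinearity in the rows, the derivative is the sum of the determinants in which one row is
    differentiated; each is then expanded along that row. *)
Lemma deriv_det (R : comNzRingType) (n : nat) (A : 'M[{poly R}]_n) :
  (\det A)^`() = \sum_i \sum_j (A i j)^`() * cofactor A i j.
Proof.
pose B i := \matrix_(k, j) (if k == i then (A k j)^`() else A k j).
transitivity (\sum_i \det (B i)).
  rewrite /determinant exchange_big raddf_sum; apply: eq_bigr => s _ /=.
  rewrite -(rmorph_sign polyC) mul_polyC derivZ deriv_prod_seq ?index_enum_uniq //.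
  rewrite -mul_polyC mulr_sumr; apply: eq_bigr => i _.
  by congr (_ * _); rewrite ?rmorph_sign //; apply: eq_bigr => j _; rewrite mxE.
apply: eq_bigr => i _; rewrite (expand_det_row _ i); apply: eq_bigr => j _.
rewrite mxE eqxx; congr (_ * (_ * \det _)); apply/matrixP=> k l.
by rewrite !mxE eq_sym (negPf (neq_lift _ _)).
Qed.

Lemma deriv_char_poly (R : comNzRingType) (n : nat) (M : 'M[R]_n) :
  (char_poly M)^`() = \tr (\adj (char_poly_mx M)).
Proof.
rewrite deriv_det; apply: eq_bigr => i _; rewrite (bigD1 i) //= big1 ?addr0.
  by rewrite !mxE eqxx derivB derivC derivX subr0 mul1r.
by move=> j ji; rewrite !mxE eq_sym (negPf ji) derivB derivC deriv0 subr0 mul0r.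
Qed.


Lemma horner_mx_coef (R : comNzRingType) (n : nat) (M : 'M[R]_n.+1) p :
  horner_mx M p = \sum_(i < size p) p`_i *: M ^+ i.
Proof.
rewrite -{1}[p]coefK poly_def raddf_sum; apply: eq_bigr => i _ /=.
by rewrite linearZ rmorphXn /= horner_mx_X.
Qed.

Section NewtonMatrix.

Variables (R : comNzRingType) (n' : nat).
Local Notation n := n'.+1.
Variable M : 'M[R]_n.
Let c i := (char_poly M)`_(n - i).
Let B k : 'M[R]_n := map_mx (coefp k) (\adj (char_poly_mx M)).

(** Comparison of the coefficients of degree [k.+1] in (X - M) adj(X - M) = chi(X). *)
Let adj_coef_rec k : B k = ((char_poly M)`_k.+1)%:M + M *m B k.+1.
Proof.
apply/matrixP=> i j; have := mul_mx_adj (char_poly_mx M).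
rewrite -/(char_poly M) {1}/char_poly_mx mulmxBl mul_scalar_mx.
move/matrixP/(_ i j)/(congr1 (coefp k.+1)).
rewrite !mxE /= coefB coefXM coefMn /= coef_sum => <-.
rewrite -[LHS](subrK (\sum_l M i l * B k.+1 l j)); congr (_ - _ + _).
by apply: eq_bigr => l _; rewrite !mxE coefCM.
Qed.

(** The recursion is unrolled downwards from the high degrees, where the coefficients of the
    adjugate vanish. *)
Let adj_coefE k : B k = \sum_(j < n - k) (char_poly M)`_(k.+1 + j) *: M ^+ j.
Proof.
have [N BN] : exists N, forall k, (N <= k)%N -> B k = 0.
  exists (\sum_i \sum_j size (\adj (char_poly_mx M) i j))%N => l lel.
  apply/matrixP=> i j; rewrite mxE [RHS]mxE /= nth_default //.
  by apply: leq_trans lel; rewrite (bigD1 i) //= (bigD1 j) //= -addnA leq_addr.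
have [m] := ubnP (maxn N n - k); elim: m k => // m IHm k lem.
have [ge|lt] := leqP (maxn N n) k.
  move: ge; rewrite geq_max => /andP[Nk nk]; rewrite BN //.
  by have /eqP -> : (n - k == 0)%N by []; rewrite big_ord0.
rewrite adj_coef_rec IHm; last by rewrite -ltnS (leq_trans _ lem) // ltnS ltn_sub2l.
have [nk|nk] := ltnP k n; last first.
  rewrite nth_default ?size_char_poly //.
  have [-> ->] : (n - k = 0 /\ n - k.+1 = 0)%N.
    by split; apply/eqP; rewrite subn_eq0 // leqW.
  by rewrite !big_ord0 mulmx0 addr0 raddf0.
rewrite -(subnSK nk) big_ord_recl addn0 expr0 scalemx1; congr (_ + _).
rewrite mulmx_sumr; apply: eq_bigr => j _.
by rewrite -scalemxAr lift0 addnS exprS.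
Qed.

(** The derivative of chi is the trace of adj(X - M), whose coefficients [adj_coefE] expresses
    through powers of M. No division occurs, so the argument works over any commutative ring. *)
Lemma newton_char_poly i : (i < n)%N ->
  c i.+1 *+ i.+1 = - \sum_(j < i.+1) c (i - j)%N * \tr (M ^+ j.+1).
Proof.
move=> lt_in; apply/eqP; rewrite -addr_eq0; apply/eqP.
(* The term j = 0 of this sum is n c_(i+1); moving it to the left gives the claim. When i + 1 = n
   the derivative carries no such coefficient, and the trace of the Cayley-Hamilton identity takes
   its place. *)
have key : c i.+1 *+ (n - i.+1) = \sum_(j < i.+2) c (i.+1 - j)%N * \tr (M ^+ j).
  have [lt|ge] := ltnP i.+1 n.
    rewrite {1}/c -(subnSK lt) -coef_deriv deriv_char_poly.
    transitivity (\tr (B (n - i.+2))).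
      by rewrite /mxtrace coef_sum; apply: eq_bigr => j _; rewrite [RHS]mxE.
    rewrite adj_coefE subKn // raddf_sum.  apply: eq_bigr => j _ /=.
    rewrite mxtraceZ /c. congr (nth 0 _ _ * _); move: (ltn_ord j); lia.
  have def_n : i.+1 = n by apply/eqP; rewrite eqn_leq lt_in.
  rewrite def_n subnn mulr0n.
  have := congr1 mxtrace (Cayley_Hamilton M).
  rewrite horner_mx_coef size_char_poly raddf_sum raddf0 => /esym E; rewrite {}[LHS]E.
  apply: eq_bigr => j _ /=; rewrite mxtraceZ /c; congr (nth 0 _ _ * _).
  by rewrite subKn // -ltnS.
move: key; rewrite big_ord_recl subn0 expr0 mxtrace1 mulrnBr //.
rewrite mulr_natr => /addrI E; rewrite -[X in X + _]opprK E addrC.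
by apply/eqP; rewrite subr_eq0; apply/eqP/eq_bigr => j _; rewrite lift0 subSS.
Qed.

End NewtonMatrix.

Lemma ncoefs_mkseq (K : fieldType) (p c : nat -> K) (n : nat) :
  [pchar K] =i pred0 -> c 0 = 1 ->
  (forall i, (i < n)%N ->
    c i.+1 *+ i.+1 = - \sum_(j < i.+1) c (i - j)%N * p j.+1) ->
  ncoefs p n = mkseq c n.+1.
Proof.
move=> chK c0; elim: n => [_|n IHn Hc]; first by rewrite /= /mkseq /= c0.
rewrite [LHS]/= IHn; last by move=> i lt_in; apply: Hc; rewrite leqW.
rewrite [RHS]mkseqS; congr rcons.
have nz : n.+1%:R != 0 :> K by rewrite (pcharf0P _).1.
apply: (mulIf nz); rewrite [RHS]mulr_natr Hc // mulrAC mulNr mulVf // mulN1r.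
congr (- _); apply: eq_bigr => j _; rewrite nth_mkseq //.
by rewrite ltnS leq_subr.
Qed.

Lemma ncoefs_mxtrace (K : fieldType) (n : nat) (M : 'M[K]_n) (i : nat) :
  [pchar K] =i pred0 -> (i <= n)%N ->
  (ncoefs (fun j => \tr (M ^+ j)) n)`_i = (char_poly M)`_(n - i).
Proof.
move=> chK; case: n M => [|n] M lein.
  by move: lein; rewrite leqn0 => /eqP ->; rewrite /char_poly det_mx00 coef1.
rewrite (@ncoefs_mkseq _ _ (fun i => (char_poly M)`_(n.+1 - i))) ?nth_mkseq //.
  by have /monicP := char_poly_monic M; rewrite lead_coefE size_char_poly.
exact: newton_char_poly.
Qed.

(** * Field extensions and Fitting's lemma *)

Lemma monic_size_le1 (R : nzRingType) (p : {poly R}) :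
  p \is monic -> (size p <= 1)%N -> p = 1.
Proof.
by move=> /[swap] /size1_polyC ->; rewrite monicE lead_coefC => /eqP ->.
Qed.

(** Irreducibility over an abstract field is not decidable, hence the classical case split inside an
    induction on the degree. *)
Lemma irreducible_factor (K : fieldType) (p : {poly K}) :
  (1 < size p)%N -> exists2 q : {poly K}, irreducible_poly q & q %| p.
Proof.
have [m] := ubnP (size p); elim: m p => // m IHm p ltpm p_gt1.
have [|red] := classic (irreducible_poly p); first by exists p.
have [q [q1 qp nqp]] :
    exists q : {poly K}, [/\ size q != 1, q %| p & ~~ (q %= p)].
  apply: NNPP => nq; case: red; split=> // q q1 qp.
  by apply: contraT => nqp; case: nq; exists q.
have p0 : p != 0 by rewrite -size_poly_gt0 ltnW.
have q0 : q != 0 by apply: contraTneq qp => ->; rewrite dvd0p.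
have ltqp : (size q < size p)%N.
  by rewrite ltn_neqAle dvdp_leq // andbT dvdp_size_eqp.
have [||r irr_r rq] := IHm q; first exact: leq_trans ltqp ltpm.
  by move: q0 q1; rewrite -size_poly_gt0; case: size => [|[]].
by exists r => //; apply: dvdp_trans rq qp.
Qed.

Lemma extension_root (K : fieldType) (p : {poly K}) : (1 < size p)%N ->
  exists (E : fieldType) (f : {rmorphism K -> E}) (x : E), root (map_poly f p) x.
Proof.
case/irreducible_factor=> q /irredp_FAdjoin[E _ [x qx _]] qp.
by exists E, (in_alg E), x; case/dvdpP: qp => r ->; rewrite rmorphM rootM qx orbT.
Qed.

Lemma extension_split (K : fieldType) (p : {poly K}) : p \is monic ->
  exists (E : fieldType) (f : {rmorphism K -> E}) (s : seq E),
    map_poly f p = \prod_(x <- s) ('X - x%:P).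
Proof.
have [m] := ubnP (size p); elim: m K p => // m IHm K p ltpm p_mon.
have [p1|p_gt1] := leqP (size p) 1.
  exists K, idfun, [::]; rewrite big_nil map_poly_id //.
  exact: monic_size_le1.
have [E [f [x /factor_theorem[q Dq]]]] := extension_root p_gt1.
have q_mon : q \is monic.
  by have := monic_map f p_mon; rewrite Dq monicMr ?monicXsubC.
have [|E' [g [s Ds]]] := IHm E q _ q_mon.
  have := size_map_poly f p; rewrite Dq size_Mmonic ?monicXsubC ?monic_neq0 //.
  by rewrite size_XsubC addn2 /= => Dsz; rewrite -ltnS Dsz.
exists E', (g \o f), (g x :: s); rewrite big_cons map_poly_comp Dq rmorphM /=.
by rewrite Ds map_polyXsubC mulrC.
Qed.

(** Write chi = h X^a with h(0) nonzero. Either h = 1, or h acquires a root in an extension, and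
    that root cannot be 0. *)
Lemma nilpotent_or_eigenvalue (K : fieldType) (n : nat) (M : 'M[K]_n.+1) :
  char_poly M = 'X^(n.+1) \/
  exists (E : fieldType) (f : {rmorphism K -> E}) (x : E),
    x != 0 /\ eigenvalue (map_mx f M) x.
Proof.
have chi0 : char_poly M != 0 by rewrite monic_neq0 ?char_poly_monic.
have [a [h nh0 Dchi]] := multiplicity_XsubC (char_poly M) 0.
rewrite chi0 /= subr0 in nh0 Dchi.
have [h1|/extension_root[E [f [x hx]]]] := leqP (size h) 1; last first.
  right; exists E, f, x; split.
    apply: contraNneq nh0 => x0; move: hx.
    by rewrite x0 -(rmorph0 f) fmorph_root.
  rewrite eigenvalue_root_char -map_char_poly Dchi rmorphM rootM hx //.
left; have h_mon : h \is monic.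
  by have := char_poly_monic M; rewrite Dchi monicMr ?monicXn.
have h1' : h = 1 by exact: monic_size_le1.
have := size_char_poly M; rewrite Dchi h1' mul1r size_polyXn => -[->] //.
Qed.

Lemma nilpotent_char_poly (K : fieldType) (n k : nat) (M : 'M[K]_n.+1) :
  M ^+ k = 0 -> char_poly M = 'X^(n.+1).
Proof.
move=> Mk; have [//|[E [f [x [x0 /eigenvalueP[v vM v0]]]]]] := nilpotent_or_eigenvalue M.
have vMk j : v *m map_mx f M ^+ j = x ^+ j *: v.
  elim: j => [|j IHj]; first by rewrite expr0 mulmx1 scale1r.
  by rewrite exprSr mulmxA IHj -scalemxAl vM scalerA exprSr.
have := vMk k; rewrite -rmorphXn /= Mk rmorph0 mulmx0 => /esym/eqP.
by rewrite scaler_eq0 expf_eq0 (negPf x0) andbF (negPf v0).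
Qed.

Lemma mxtrace_nilpotent (K : fieldType) (n k : nat) (M : 'M[K]_n.+1) :
  M ^+ k = 0 -> \tr M = 0.
Proof.
move/nilpotent_char_poly=> chiM; apply: oppr_inj.
by rewrite -char_poly_trace // chiM coefXn /= ltn_eqF // oppr0.
Qed.

(** In the rank factorization e = C R, idempotence forces R C to be the identity of size [\rank e],
    and tr(C R) = tr(R C). *)
Lemma mxtrace_idempotent (K : fieldType) (n : nat) (e : 'M[K]_n) :
  e *m e = e -> \tr e = (\rank e)%:R.
Proof.
move=> ee; have rc1 : row_base e *m col_base e = 1%:M.
  apply: (row_free_inj (row_base_free e)); rewrite /= mul1mx.
  apply: (row_full_inj (col_base_full e)).
  by rewrite /= -mulmxA [LHS]mulmxA !mulmx_base.
have -> : \tr e = \tr (col_base e *m row_base e) by rewrite mulmx_base.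
by rewrite mxtrace_mulC rc1 mxtrace1.
Qed.

(** Fitting's decomposition inside the corner of e. With g = X^a h, h prime to X, and u X^a + v h =
    1, the polynomial p = u X^a is idempotent modulo g, so e p(w) is 0 or e. In the first case w^a =
    0; in the second, u X^(a-1) provides the inverse of w in the corner. *)
Lemma fitting (K : fieldType) (n : nat) (e w : 'M[K]_n.+1) :
  e * e = e -> e * w = w -> w * e = w ->
  (forall p : {poly K}, let f := e * horner_mx w p in
     f * f = f -> f = 0 \/ f = e) ->
  (exists k, w ^+ k = 0) \/ (exists p, w * (e * horner_mx w p) = e).
Proof.
(* The extra factor X ensures a > 0 even when w is invertible, so that X^(a-1) makes sense. *)
move=> ee ew we prim; pose g := char_poly w * 'X.
have g0 : g != 0 by rewrite mulf_neq0 ?monic_neq0 ?char_poly_monic ?monicX.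
have wg : horner_mx w g = 0 by rewrite rmorphM /= Cayley_Hamilton mul0r.
have [a [h nh0 Dg]] := multiplicity_XsubC g 0.
rewrite g0 /= subr0 in nh0 Dg.
have a_gt0 : (0 < a)%N.
  case: a Dg => // Dg; move: nh0; have -> : h = g by rewrite Dg expr0 mulr1.
  by rewrite /g rootM rootX eqxx orbT.
have cop : coprimep ('X ^+ a) h.
  by apply: coprimep_expl; rewrite coprimep_sym -['X]subr0 coprimep_XsubC.
have [[u v] /= Euv] := Bezout_eq1_coprimepP _ _ cop.
have ce p : e * horner_mx w p = horner_mx w p * e.
  by apply: comm_mx_horner; rewrite /comm_mx [LHS]ew [RHS]we.
have Ag p : horner_mx w (p * g) = 0 by rewrite rmorphM /= wg mulr0.
pose p := u * 'X ^+ a; have pp : horner_mx w (p * p) = horner_mx w p.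
  have -> : p * p = p - u * v * g.
    have Ep : p = 1 - v * h by rewrite -Euv addrK.
    by rewrite {2}Ep mulrBr mulr1 Dg; congr (_ - _); rewrite /p; ring.
  by rewrite rmorphB /= Ag subr0.
have [| ep0 | epe] := prim p.
- by rewrite {1}ce mulrA -[_ * e * e]mulrA ee -ce -mulrA -rmorphM /= pp.
- left; exists a.
  have ewa : e * w ^+ a = w ^+ a.
    by case: (a) a_gt0 => // a' _; rewrite exprS mulrA ew.
  rewrite -ewa -[w in w ^+ a](horner_mx_X w) -rmorphXn /= -['X ^+ a]mul1r -Euv mulrDl.
  by rewrite -[v * h * _]mulrA -Dg rmorphD /= Ag addr0 rmorphM /= mulrA ep0 mul0r.
- right; exists (u * 'X ^+ a.-1).
  rewrite mulrA we -{1}ew -mulrA -[X in X * horner_mx _ _](horner_mx_X w) -rmorphM /=.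
  have -> : 'X * (u * 'X ^+ a.-1) = p by rewrite mulrCA -exprS prednK.
  by rewrite -[RHS]epe.
Qed.

(** * The regular representation and the trace form *)

Section RegularRepresentation.

Variables (F : fieldType) (S : falgType F) (n : nat) (e : n.+1.-tuple S).
Hypothesis e_basis : basis_of fullv e.

Let lreg (a : S) : 'M[F]_n.+1 := \matrix_(k, l) coord e k (a * e`_l).

Let lreg_linear : linear lreg.
Proof.
by move=> k a b; apply/matrixP=> i j; rewrite !mxE mulrDl -scalerAl linearP.
Qed.

Let lreg_monoid_morphism : monoid_morphism lreg.
Proof.
split=> [|a b]; apply/matrixP=> i j; rewrite !mxE.
  by rewrite mul1r coord_free ?(basis_free e_basis) // eq_sym.
rewrite -mulrA {1}[b * _](coord_basis e_basis) ?memvf // mulr_sumr linear_sum.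
by apply: eq_bigr => k _ /=; rewrite !mxE -scalerAr linearZ mulrC.
Qed.

HB.instance Definition _ := GRing.isSemilinear.Build F S _ _ lreg
  (GRing.semilinear_linear lreg_linear).
HB.instance Definition _ := GRing.isMonoidMorphism.Build S _ lreg
  lreg_monoid_morphism.

Lemma regular_representation : exists L : {lrmorphism S -> 'M[F]_n.+1},
  injective L /\ forall a, \tr (L a) = \sum_k coord e k (a * e`_k).
Proof.
exists lreg; split=> [|a]; last by apply: eq_bigr => k _; rewrite mxE.
apply: raddf_inj => a /matrixP La0.
rewrite -[a]mulr1 [1](coord_basis e_basis) ?memvf // mulr_sumr big1 // => l _.
rewrite -scalerAr (_ : a * e`_l = 0) ?scaler0 //.
rewrite [a * _](coord_basis e_basis) ?memvf // big1 // => k _.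
by have := La0 k l; rewrite !mxE => ->; rewrite scale0r.
Qed.

End RegularRepresentation.

(** The trace is given in two forms: [lfun_trace] enters the reduced trace, and the coordinates
    serve to compute the Casimir element. *)
Lemma falg_regular (F : fieldType) (S : falgType F) :
  exists n, \dim {:S} = n.+1 /\
  exists L : {lrmorphism S -> 'M[F]_n.+1},
    [/\ injective L, forall a, \tr (L a) = lfun_trace (amull a) &
        exists2 e : n.+1.-tuple S, basis_of fullv e &
        forall a, \tr (L a) = \sum_k coord e k (a * e`_k)].
Proof.
have trE a : lfun_trace (amull a) =
    \sum_k coord (vbasis {:S}) k (a * (vbasis {:S})`_k).
  rewrite /lfun_trace /mxtrace; apply: eq_bigr => k _.
  by rewrite !mxE /= passmx.vecof_delta lfunE.
have dimS : (0 < \dim {:S})%N by rewrite adim_gt0.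
move: (vbasis _) (vbasisP {:S}) trE dimS; case: (\dim _) => // n e e_basis trE _.
exists n; split=> //; have [L [L_inj trL]] := regular_representation e_basis.
by exists L; split=> // [a|]; [rewrite trL trE | exists e].
Qed.

(** In characteristic 0, Newton's identities make all the lower coefficients of chi vanish, and
    Cayley-Hamilton concludes. *)
Lemma mxtrace_exp_nilpotent (K : fieldType) (n : nat) (M : 'M[K]_n.+1) :
  [pchar K] =i pred0 -> (forall j, \tr (M ^+ j.+1) = 0) -> M ^+ n.+1 = 0.
Proof.
move=> chK trM; have chi i : (i < n.+1)%N -> (char_poly M)`_(n.+1 - i.+1) = 0.
  move=> lti; have := newton_char_poly M lti.
  rewrite big1 => [/eqP|j _]; last by rewrite trM mulr0.
  by rewrite oppr0 -mulr_natr mulf_eq0 (pcharf0P _).1 // orbF => /eqP.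
have {}chi i : (i < n.+1)%N -> (char_poly M)`_i = 0.
  move=> lti; have := chi (n - i)%N; rewrite subSS subKn //; apply.
  by rewrite ltnS leq_subr.
have := Cayley_Hamilton M; rewrite horner_mx_coef size_char_poly big_ord_recr /=.
rewrite big1 ?add0r => [|i _]; last by rewrite chi ?scale0r.
have /monicP := char_poly_monic M; rewrite lead_coefE size_char_poly /= => ->.
by rewrite scale1r.
Qed.

Section TraceForm.

Variables (F : fieldType) (S : falgType F) (n : nat).
Variable L : {lrmorphism S -> 'M[F]_n.+1}.
Hypothesis L_inj : injective L.
Hypothesis chF : [pchar F] =i pred0.

Local Notation tr a := (\tr (L a)).

Lemma trLC a b : \tr (L (a * b)) = \tr (L (b * a)).
Proof. by rewrite !rmorphM /= mxtrace_mulC. Qed.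

Lemma trL_sum (I : finType) (E : I -> S) :
  \tr (L (\sum_i E i)) = \sum_i \tr (L (E i)).
Proof. by rewrite !raddf_sum. Qed.

Lemma trLZ k a : \tr (L (k *: a)) = k * \tr (L a).
Proof. by rewrite linearZ mxtraceZ. Qed.

(** The radical of the form is a nil ideal; if x in it is nonzero with xS of
    minimal dimension, primeness gives xsx <> 0 and then x = x(sxz), with sxz
    nilpotent. *)
Lemma trace_form_nondegenerate (x : S) : prime_ring S ->
  (forall y, \tr (L (x * y)) = 0) -> x = 0.
Proof.
move=> [_ primeS].
have nilJ t : (forall y, tr (t * y) = 0) -> exists k, t ^+ k = 0.
  move=> Jt; exists n.+1; apply: L_inj; rewrite rmorphXn rmorph0.
  apply: mxtrace_exp_nilpotent => // j.
  by rewrite -rmorphXn exprS; apply: Jt.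
have [m] := ubnP (\dim (limg (amull x))); elim: m x => // m IHm x ltm Jx.
apply: NNPP => x0.
have [s xsx] : exists s, x * s * x <> 0.
  apply: NNPP => no; case: (primeS x x) => // s.
  by apply: NNPP => xsx; case: no; exists s.
have sub : (limg (amull (x * s * x)%R) <= limg (amull x))%VS.
  apply/subvP=> _ /memv_imgP[u _ ->]; rewrite lfunE /= -!mulrA.
  by apply/memv_imgP; exists (s * (x * u)); rewrite ?memvf // lfunE.
have [lt|ge] := ltnP (\dim (limg (amull (x * s * x)%R))) (\dim (limg (amull x))).
  case: xsx; apply: IHm => [|y]; first by rewrite -ltnS (leq_trans _ ltm).
  by rewrite -!mulrA; apply: Jx.
have : x \in limg (amull (x * s * x)%R).
  have /eqP -> : limg (amull (x * s * x)%R) == limg (amull x) by rewrite eqEdim sub.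
  by apply/memv_imgP; exists 1; rewrite ?memvf // lfunE /= mulr1.
case/memv_imgP=> z _; rewrite lfunE /= => Ex.
have [|k tk0] := nilJ (s * x * z).
  by move=> y; rewrite -!mulrA trLC -!mulrA; apply: Jx.
have xt j : x = x * (s * x * z) ^+ j.
  elim: j => [|j IHj]; first by rewrite mulr1.
  by rewrite exprS mulrA !(mulrA x) -Ex.
by case: x0; rewrite (xt k) tk0 mulr0.
Qed.

(** The inverse of the Gram matrix of b transforms b into its dual basis. The subspace V is kept
    general because both S and its center are needed. *)
Lemma dual_basis (V : {vspace S}) (p : nat) (b : p.-tuple S) :
  basis_of V b ->
  (forall x, x \in V -> (forall y, y \in V -> tr (x * y) = 0) -> x = 0) ->
  exists c : 'I_p -> S,
  [/\ forall k, c k \in V, forall k l : 'I_p, tr (b`_k * c l) = (k == l)%:R,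
      forall y, y \in V -> y = \sum_(k < p) tr (y * b`_k) *: c k &
      forall y, y \in V -> y = \sum_(k < p) tr (y * c k) *: b`_k].
Proof.
move=> b_basis nondeg; pose G : 'M[F]_p := \matrix_(k, l) tr (b`_k * b`_l).
have Vb (k : 'I_p) : b`_k \in V by apply: (basis_mem b_basis); rewrite mem_nth ?size_tuple.
have GU : G \in unitmx.
  rewrite -row_free_unit -kermx_eq0; apply/eqP/row_matrixP=> i; rewrite row0.
  (* A row u in the kernel of the Gram matrix yields a combination of the b_k orthogonal to V, which
     is zero by nondegeneracy. *)
  set u := row i _; have uG : u *m G = 0 by apply/sub_kermxP/row_sub.
  have ub : \sum_k u 0 k *: b`_k = 0.
    apply: nondeg => [|y /(coord_basis b_basis) ->].
      by apply: memv_suml => k _; apply: memvZ.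
    rewrite mulr_sumr trL_sum big1 // => l _; rewrite -scalerAr trLZ.
    have /rowP/(_ l) := uG; rewrite !mxE => E; rewrite -[RHS](mulr0 (coord b l y)) -E.
    rewrite mulr_suml trL_sum; congr (_ * _); apply: eq_bigr => k _.
    by rewrite -scalerAl trLZ !mxE.
  by apply/rowP=> k; rewrite [RHS]mxE; apply: (freeP (basis_free b_basis)) ub k.
pose c l := \sum_k invmx G l k *: b`_k.
have Vc k : c k \in V by apply: memv_suml => l _; apply: memvZ.
have cb (l k : 'I_p) : tr (c l * b`_k) = (l == k)%:R.
  have /matrixP/(_ l k) := mulVmx GU; rewrite !mxE => <-.
  rewrite mulr_suml trL_sum; apply: eq_bigr => j _.
  by rewrite -scalerAl trLZ mxE.
have bc (k l : 'I_p) : tr (b`_k * c l) = (k == l)%:R by rewrite trLC cb eq_sym.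
exists c; split=> // y Vy; last first.
  rewrite {1}(coord_basis b_basis Vy); apply: eq_bigr => k _; congr (_ *: _).
  rewrite {2}(coord_basis b_basis Vy) mulr_suml trL_sum (bigD1 k) //= big1.
    by rewrite addr0 -scalerAl trLZ bc eqxx mulr1.
  by move=> j jk; rewrite -scalerAl trLZ bc (negPf jk) mulr0.
apply/eqP; rewrite -subr_eq0; apply/eqP; apply: nondeg.
  by rewrite rpredB // memv_suml // => k _; apply: memvZ.
move=> v /(coord_basis b_basis) ->; rewrite mulr_sumr trL_sum big1 // => l _.
rewrite -scalerAr trLZ mulrBl raddfB raddfB /= mulr_suml trL_sum (bigD1 l) //= big1.
  by rewrite addr0 -scalerAl trLZ cb eqxx mulr1 subrr mulr0.
by move=> k kl; rewrite -scalerAl trLZ cb (negPf kl) mulr0.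
Qed.

End TraceForm.

(** * Casimir elements *)

(** [b], [c] are dual bases of the algebra, and [z], [w] dual bases of its
    center, for the trace form [\tr (L (x * y))]; [L] is a representation whose
    trace is the regular one, whence [casimir_l]. *)
Record casimir_data (F : fieldType) (S : falgType F) (n m p : nat)
    (L : S -> 'M[F]_n) (b c : 'I_m -> S) (z w : 'I_p -> S) : Prop :=
  CasimirData {
    dual_left : forall y, y = \sum_k \tr (L (y * b k)) *: c k;
    dual_right : forall y, y = \sum_k \tr (L (y * c k)) *: b k;
    casimir_l : \sum_k b k * c k = 1;
    casimir_r : \sum_k c k * b k = 1;
    casimir_central : forall x s,
      s * (\sum_k b k * x * c k) = (\sum_k b k * x * c k) * s;
    center_z : forall l s, s * z l = z l * s;
    center_w : forall l s, s * w l = w l * s;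
    center_dual : forall y, (forall s, s * y = y * s) ->
      y = \sum_l \tr (L (y * z l)) *: w l;
    center_trace : forall l, \tr (L (z l * w l)) = 1
  }.

Lemma casimir_exists (F : fieldType) (S : falgType F) (n : nat)
    (L : {lrmorphism S -> 'M[F]_n.+1}) (e : n.+1.-tuple S) :
  [pchar F] =i pred0 -> prime_ring S -> injective L -> basis_of fullv e ->
  (forall a, \tr (L a) = \sum_k coord e k (a * e`_k)) ->
  exists (c : 'I_n.+1 -> S) (z w : 'I_(\dim 'Z({:S})) -> S),
    casimir_data L (fun k => e`_k) c z w.
Proof.
move=> chF primeS L_inj e_basis trE.
have nondeg := trace_form_nondegenerate L_inj chF primeS.
have [c [_ ec Ec Ee]] : exists c : 'I_n.+1 -> S,
    [/\ forall k, c k \in fullv, forall k l : 'I_n.+1, \tr (L (e`_k * c l)) = (k == l)%:R,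
      forall y, y \in fullv -> y = \sum_(k < n.+1) \tr (L (y * e`_k)) *: c k &
      forall y, y \in fullv -> y = \sum_(k < n.+1) \tr (L (y * c k)) *: e`_k].
  apply: dual_basis => // x _ Hx; apply: nondeg => y; apply: Hx; exact: memvf.
have {}Ec y := Ec y (memvf y); have {}Ee y := Ee y (memvf y).
have coordE y k : coord e k y = \tr (L (y * c k)).
  by rewrite {1}(Ee y) coord_sum_free ?(basis_free e_basis).
(* As tr is the regular trace, tr y = sum_k tr(y e_k c_k) for every y; nondegeneracy gives the
   equality. *)
have C1 : \sum_(k < n.+1) e`_k * c k = 1.
  apply/eqP; rewrite -subr_eq0; apply/eqP; apply: nondeg => y.
  rewrite trLC mulrBr mulr1 !raddfB /= [\tr (L y)]trE mulr_sumr trL_sum.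
  by apply/eqP; rewrite subr_eq0; apply/eqP/eq_bigr => k _; rewrite coordE mulrA.
(* Expanding e_k in the dual basis gives sum_(k,l) tr(e_k e_l) c_k c_l for both orders of the
   factors, by symmetry of the form. *)
have C2 : \sum_(k < n.+1) c k * e`_k = 1.
  rewrite -C1; transitivity (\sum_(k < n.+1) \sum_(l < n.+1)
      \tr (L (e`_k * e`_l)) *: (c k * c l)).
    apply: eq_bigr => k _; rewrite {1}(Ec e`_k) mulr_sumr.
    by apply: eq_bigr => l _; rewrite scalerAr.
  rewrite exchange_big; apply: eq_bigr => k _ /=.
  rewrite {2}(Ec e`_k) mulr_suml; apply: eq_bigr => l _.
  by rewrite trLC scalerAl.
pose P x := \sum_(k < n.+1) e`_k * x * c k.
(* The coefficient of e_l in s e_k and that of c_k in c_l s are equal, by cyclicity of the trace. *)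
have Pcent x s : s * P x = P x * s.
  transitivity (\sum_(k < n.+1) \sum_(l < n.+1)
      \tr (L (s * e`_k * c l)) *: (e`_l * x * c k)).
    rewrite mulr_sumr; apply: eq_bigr => k _.
    rewrite !mulrA {1}(Ee (s * e`_k)) !mulr_suml.
    by apply: eq_bigr => l _; rewrite !scalerAl.
  rewrite exchange_big mulr_suml; apply: eq_bigr => l _ /=.
  rewrite -[RHS]mulrA (Ec (c l * s)) mulr_sumr; apply: eq_bigr => k _.
  by rewrite -scalerAr [in LHS]trLC mulrA.
have centP y : reflect (forall s, s * y = y * s) (y \in 'Z({:S})%VS).
  rewrite memv_cap memvf /=; apply: (iffP centvP) => [cy s|cy s _] //.
  by rewrite cy ?memvf.
(* The form stays nondegenerate on the center: for x central, tr(x y) = tr(x P(y)), because sum_k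
   c_k e_k = 1, and P(y) is central. *)
have [|w [Zw zw Ew _]] := dual_basis (L := L) (vbasisP 'Z({:S})%VS).
  move=> x /centP cx Hx; apply: nondeg => y.
  have /Hx : P y \in 'Z({:S})%VS by apply/centP; apply: Pcent.
  rewrite mulr_sumr trL_sum => E; rewrite -[y]mulr1 -C2 !mulr_sumr trL_sum -[RHS]E.
  by apply: eq_bigr => k _; rewrite !mulrA trLC !mulrA cx.
have Zz (l : 'I_(\dim 'Z({:S})%VS)) : (vbasis 'Z({:S})%VS)`_l \in 'Z({:S})%VS.
  by rewrite vbasis_mem // mem_nth // size_tuple.
exists c, (fun l => (vbasis 'Z({:S})%VS)`_l), w; split=> //.
- by move=> l; apply/centP.
- by move=> l; apply/centP.
- by move=> y /centP; apply: Ew.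
- by move=> l; rewrite zw eqxx.
Qed.

(** * Splitting by idempotents over field extensions *)

Lemma pchar0_morph (F K : fieldType) (f : {rmorphism F -> K}) :
  [pchar F] =i pred0 -> [pchar K] =i pred0.
Proof. by move=> chF p; rewrite (fmorph_pchar f) chF. Qed.

Lemma pchar0_natr_inj (K : fieldType) : [pchar K] =i pred0 ->
  injective (fun k : nat => k%:R : K).
Proof.
move=> /pcharf0P chK k l; wlog lekl : k l / (k <= l)%N.
  by move=> W; case/orP: (leq_total k l) => /W // W' /esym/W'.
move=> /esym/eqP; rewrite -subr_eq0 -natrB // chK subn_eq0 => lelk.
by apply/eqP; rewrite eqn_leq lekl.
Qed.

Lemma exists_max (P : nat -> Prop) (r0 N : nat) :
  P r0 -> (forall r, P r -> (r <= N)%N) ->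
  exists2 r, P r & forall r', P r' -> (r' <= r)%N.
Proof.
move=> Pr0 leN; have [m] := ubnP (N - r0); elim: m r0 Pr0 => // m IHm r Pr ltm.
have [[r' [Pr' ltr]]|no] := classic (exists r', P r' /\ (r < r')%N).
  by apply: (IHm r') => //; have := leN _ Pr'; lia.
exists r => // r' Pr'; rewrite leqNgt; apply/negP=> ltr; case: no.
by exists r'.
Qed.

Section Split.

Variables (F : fieldType) (S : falgType F) (n m p : nat).
Variable L : {lrmorphism S -> 'M[F]_n.+1}.
Variables (b c : 'I_m -> S) (z w : 'I_p -> S).
Hypothesis chF : [pchar F] =i pred0.
Hypothesis casS : casimir_data L b c z w.

Section Extension.

Variables (K : fieldType) (f : {rmorphism F -> K}).

Definition ext_rep a : 'M[K]_n.+1 := map_mx f (L a).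

(** This span plays the part of S tensored with K, realized inside a matrix algebra so that passing
    to a larger field is just [map_mx]. *)
Definition in_span (x : 'M[K]_n.+1) : Prop :=
  exists u : 'I_m -> K, x = \sum_k u k *: ext_rep (b k).

Lemma ext_repM x y : ext_rep (x * y) = ext_rep x * ext_rep y.
Proof. by rewrite /ext_rep rmorphM /= map_mxM. Qed.

Lemma ext_rep1 : ext_rep 1 = 1.
Proof. by rewrite /ext_rep rmorph1 /= map_mx1. Qed.

Lemma ext_rep_sum (I : finType) (E : I -> S) : ext_rep (\sum_i E i) = \sum_i ext_rep (E i).
Proof. by rewrite /ext_rep !raddf_sum. Qed.

Lemma ext_repB x y : ext_rep (x - y) = ext_rep x - ext_rep y.
Proof. by rewrite /ext_rep !raddfB. Qed.

Lemma ext_repZ k x : ext_rep (k *: x) = f k *: ext_rep x.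
Proof. by rewrite /ext_rep linearZ map_mxZ. Qed.

Lemma mxtrace_ext_rep x : \tr (ext_rep x) = f (\tr (L x)).
Proof. exact: trace_map_mx. Qed.

Lemma span_ext_rep a : in_span (ext_rep a).
Proof.
exists (fun k => f (\tr (L (a * c k)))); rewrite {1}(dual_right casS a) ext_rep_sum.
by apply: eq_bigr => k _; rewrite ext_repZ.
Qed.

Lemma span_add x y : in_span x -> in_span y -> in_span (x + y).
Proof.
move=> [u ->] [v ->]; exists (fun k => u k + v k); rewrite -big_split.
by apply: eq_bigr => k _; rewrite scalerDl.
Qed.

Lemma span_scale t x : in_span x -> in_span (t *: x).
Proof.
move=> [u ->]; exists (fun k => t * u k); rewrite scaler_sumr.
by apply: eq_bigr => k _; rewrite scalerA.
Qed.

Lemma span_sum (I : finType) (E : I -> 'M[K]_n.+1) :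
  (forall i, in_span (E i)) -> in_span (\sum_i E i).
Proof.
move=> TE; elim/big_ind: _ => // [|x y]; last exact: span_add.
by rewrite -(scale0r (ext_rep 1)); apply/span_scale/span_ext_rep.
Qed.

Lemma span_opp x : in_span x -> in_span (- x).
Proof. by rewrite -scaleN1r; apply: span_scale. Qed.

Lemma span_mul x y : in_span x -> in_span y -> in_span (x * y).
Proof.
move=> [u ->] [v ->]; rewrite mulr_suml; apply: span_sum => k.
rewrite mulr_sumr; apply: span_sum => l; rewrite -scalerAl -scalerAr -ext_repM.
by do 2!apply: span_scale; apply: span_ext_rep.
Qed.

Lemma span_one : in_span 1.
Proof. by rewrite -ext_rep1; apply: span_ext_rep. Qed.

Lemma span_horner x q : in_span x -> in_span (horner_mx x q).
Proof.
move=> Tx; rewrite horner_mx_coef; apply: span_sum => i; apply: span_scale.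
elim: (i : nat) => [|k IHk]; first exact: span_one.
by rewrite exprS; apply: span_mul.
Qed.

Lemma span_expand x : in_span x ->
  x = \sum_k \tr (x * ext_rep (b k)) *: ext_rep (c k).
Proof.
case=> u ->; transitivity (\sum_l u l *: \sum_k \tr (ext_rep (b l) * ext_rep (b k)) *: ext_rep (c k)).
  apply: eq_bigr => l _; congr (_ *: _); rewrite {1}(dual_left casS (b l)) ext_rep_sum.
  by apply: eq_bigr => k _; rewrite ext_repZ -ext_repM mxtrace_ext_rep.
under eq_bigr do rewrite scaler_sumr.
rewrite exchange_big; apply: eq_bigr => k _ /=.
rewrite mulr_suml raddf_sum scaler_suml; apply: eq_bigr => l _ /=.
by rewrite scalerA -scalerAl mxtraceZ.
Qed.

Lemma span_nondegenerate x : in_span x ->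
  (forall y, in_span y -> \tr (x * y) = 0) -> x = 0.
Proof.
move=> Tx Hx; rewrite (span_expand Tx) big1 // => k _.
by rewrite Hx ?scale0r //; apply: span_ext_rep.
Qed.

Definition idempotent_system r (e : 'I_r -> 'M[K]_n.+1) : Prop :=
  [/\ forall i, in_span (e i), forall i, e i != 0,
      forall i j, e i * e j = if i == j then e i else 0 & \sum_i e i = 1].

(** Traces of idempotents are their ranks, at least 1 each, and they add up to the trace of 1;
    characteristic 0 turns this into an equality of integers. *)
Lemma idempotent_system_size r (e : 'I_r -> 'M[K]_n.+1) :
  idempotent_system e -> (r <= n.+1)%N.
Proof.
move=> [_ e0 ee e1]; have chK := pchar0_morph f chF.
have trE : (n.+1%:R : K) = (\sum_i \rank (e i))%:R.
  rewrite -[n.+1%:R]mxtrace1 -[1%:M]/(1 : 'M[K]_n.+1) -e1 raddf_sum natr_sum.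
  by apply: eq_bigr => i _; apply: mxtrace_idempotent; have := ee i i; rewrite eqxx.
rewrite (pchar0_natr_inj chK trE).
rewrite -[r in (r <= _)%N]card_ord -sum1_card; apply: leq_sum => i _.
by rewrite lt0n mxrank_eq0.
Qed.

(** A proper nonzero idempotent g of the corner of e_i splits e_i as g + (e_i - g); g is put at
    index 0 and e_i - g takes the place of e_i. *)
Lemma idempotent_system_refine r (e : 'I_r -> 'M[K]_n.+1) i g :
  idempotent_system e -> in_span g -> g * g = g ->
  e i * g = g -> g * e i = g -> g <> 0 -> g <> e i ->
  exists e' : 'I_r.+1 -> 'M[K]_n.+1, idempotent_system e'.
Proof.
move=> [Te e0 ee e1] Tg gg eg ge /eqP g0 /eqP gne.
pose h j := if j == i then e i - g else e j.
have gej j : g * e j = if i == j then g else 0.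
  rewrite -{1}ge -mulrA ee; case: eqP => _; [exact: ge | exact: mulr0].
have ejg j : e j * g = if i == j then g else 0.
  rewrite -{1}eg mulrA ee eq_sym; case: eqP => [<-|_]; [exact: eg | exact: mul0r].
have gh j : g * h j = 0.
  by rewrite /h; have [_|ji] := eqVneq j i; rewrite ?mulrBr ?ge ?gg ?subrr // gej eq_sym (negPf ji).
have hg j : h j * g = 0.
  by rewrite /h; have [_|ji] := eqVneq j i; rewrite ?mulrBl ?eg ?gg ?subrr // ejg eq_sym (negPf ji).
have hh j k : h j * h k = if j == k then h j else 0.
  rewrite {2}/h; have [->|ki] := eqVneq k i.
    rewrite mulrBr hg subr0 /h; have [_|ji] := eqVneq j i.
      by rewrite mulrBl ee eqxx ge.
    by rewrite ee (negPf ji).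
  rewrite /h; have [->|ji] := eqVneq j i; last by rewrite ee.
  by rewrite mulrBl ee gej eq_sym (negPf ki) subr0.
exists (fun j => if unlift ord0 j is Some k then h k else g); split.
- move=> j; case: unliftP => // k _; rewrite /h; case: eqP => // _.
  by apply: span_add => //; apply: span_opp.
- move=> j; case: unliftP => // k _; rewrite /h; case: (eqVneq k i) => // _.
  by rewrite subr_eq0 eq_sym.
- move=> j k; case: (unliftP ord0 j) => [j'|] ->; case: (unliftP ord0 k) => [k'|] -> //.
rewrite big_ord_recl unlift_none; under eq_bigr do rewrite liftK.
rewrite -e1 (bigD1 i) //= [RHS](bigD1 i) //= addrA {1}/h eqxx [g + _]addrC subrK.
by congr (_ + _); apply: eq_bigr => j /negPf ji; rewrite /h ji.
Qed.

End Extension.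
End Split.

(** * Maximal idempotent systems and their corners *)

Section MaximalSystem.

Variables (F : fieldType) (S : falgType F) (n m p : nat).
Variable L : {lrmorphism S -> 'M[F]_n.+1}.
Variables (b c : 'I_m -> S) (z w : 'I_p -> S).
Hypothesis chF : [pchar F] =i pred0.
Hypothesis casS : casimir_data L b c z w.

Lemma map_ext_rep (K E : fieldType) (f : {rmorphism F -> K}) (g : {rmorphism K -> E}) a :
  map_mx g (ext_rep L f a) = ext_rep L (g \o f) a.
Proof. by apply/matrixP=> i j; rewrite !mxE. Qed.

Lemma map_span (K E : fieldType) (f : {rmorphism F -> K}) (g : {rmorphism K -> E}) x :
  in_span L b f x -> in_span L b (g \o f) (map_mx g x).
Proof.
case=> u ->; exists (g \o u); rewrite raddf_sum;  apply: eq_bigr => k _ /=.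
by rewrite map_mxZ map_ext_rep.
Qed.

Lemma map_idempotent_system (K E : fieldType) (f : {rmorphism F -> K})
    (g : {rmorphism K -> E}) r (e : 'I_r -> 'M[K]_n.+1) :
  idempotent_system L b f e ->
  idempotent_system L b (g \o f) (fun i => map_mx g (e i)).
Proof.
move=> [Te e0 ee e1]; split=> [i|i|i j|].
- exact: map_span.
- by rewrite /= map_mx_eq0.
- rewrite -[LHS]map_mxM [_ *m _]ee; by case: eqP => // _; rewrite map_mx0.
- by rewrite -raddf_sum e1; apply: map_mx1.
Qed.

(** The size is maximal among systems over all extensions of [F], so that the
    idempotents stay primitive after any further extension. *)
Definition maximal_system (K : fieldType) (f : {rmorphism F -> K}) r
    (e : 'I_r -> 'M[K]_n.+1) : Prop :=
  idempotent_system L b f e /\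
  forall (E : fieldType) (g : {rmorphism F -> E}) s (e' : 'I_s -> 'M[E]_n.+1),
    idempotent_system L b g e' -> (s <= r)%N.

Lemma maximal_system_exists :
  exists (K : fieldType) (f : {rmorphism F -> K}) r (e : 'I_r -> 'M[K]_n.+1),
    maximal_system f e.
Proof.
pose P r := exists (K : fieldType) (f : {rmorphism F -> K}) (e : 'I_r -> 'M[K]_n.+1),
  idempotent_system L b f e.
have P1 : P 1.
  exists F, idfun, (fun=> 1); split=> [_|_|i j|].
  - exact: (span_one casS).
  - exact: oner_neq0.
  - by rewrite !ord1 eqxx mulr1.
  - by rewrite big_ord1.
have [r [K [f [e sys]]] maxr] := exists_max P1
  (fun r '(ex_intro K (ex_intro f (ex_intro e sys))) => idempotent_system_size chF sys).
exists K, f, r, e; split=> // E g s e' sys'; apply: maxr.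
by exists E, g, e'.
Qed.

Lemma map_maximal_system (K E : fieldType) (f : {rmorphism F -> K})
    (g : {rmorphism K -> E}) r (e : 'I_r -> 'M[K]_n.+1) :
  maximal_system f e -> maximal_system (g \o f) (fun i => map_mx g (e i)).
Proof. by case=> sys maxr; split=> //; apply: map_idempotent_system. Qed.

Section Corner.

Variables (K : fieldType) (f : {rmorphism F -> K}).
Variables (r : nat) (e : 'I_r -> 'M[K]_n.+1).
Hypothesis max_e : maximal_system f e.

Let Te i : in_span L b f (e i). Proof. by case: max_e => -[]. Qed.
Let e0 i : e i != 0. Proof. by case: max_e => -[]. Qed.
Let ee i : e i * e i = e i.
Proof. by case: max_e => -[_ _ /(_ i i)]; rewrite eqxx. Qed.

(** By maximality e_i is primitive: an idempotent e_i q(x) other than 0 and e_i would refine the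
    system. Fitting's lemma then applies. *)
Lemma corner_dichotomy i (x : 'M[K]_n.+1) :
  in_span L b f x -> e i * x = x -> x * e i = x ->
  (exists k, x ^+ k = 0) \/ (exists y, in_span L b f y /\ x * y = e i).
Proof.
move=> Tx ex xe; have prim q : let g := e i * horner_mx x q in
    g * g = g -> g = 0 \/ g = e i.
  move=> g; have Tg : in_span L b f g by exact/(span_mul casS)/(span_horner casS).
  have eg : e i * g = g by rewrite /g mulrA ee.
  have ge : g * e i = g.
    have ce : e i * horner_mx x q = horner_mx x q * e i.
      by apply: comm_mx_horner; rewrite /comm_mx [LHS]ex [RHS]xe.
    by rewrite /g -mulrA -ce mulrA ee.
  move=> gg; apply: NNPP => no.
  have [||e' sys'] := idempotent_system_refine max_e.1 Tg gg eg ge.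
  - by move=> g0; apply: no; left.
  - by move=> gi; apply: no; right.
  by have := max_e.2 _ _ _ _ sys'; rewrite ltnn.
have [|[q xq]] := fitting (ee i) ex xe prim; first by left.
right; exists (e i * horner_mx x q); split=> //.
exact/(span_mul casS)/(span_horner casS).
Qed.

Lemma corner_trace_neq0 i : \tr (e i) != 0.
Proof.
rewrite (mxtrace_idempotent (ee i)) (pcharf0P _).1 ?mxrank_eq0 //.
exact: pchar0_morph f chF.
Qed.

End Corner.

Section CornerScalars.

Variables (K : fieldType) (f : {rmorphism F -> K}).
Variables (r : nat) (e : 'I_r -> 'M[K]_n.+1).
Hypothesis max_e : maximal_system f e.

Let Te i : in_span L b f (e i). Proof. by case: max_e => -[]. Qed.
Let e0 i : e i != 0. Proof. by case: max_e => -[]. Qed.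
Let ee i : e i * e i = e i.
Proof. by case: max_e => -[_ _ /(_ i i)]; rewrite eqxx. Qed.

(** Otherwise y has an eigenvalue x <> 0 over some extension, where e_i is still primitive. Then u =
    y - x e_i is nilpotent or invertible in the corner: nilpotency would give 0 = tr u = - x
    tr(e_i), and invertibility is excluded by the eigenvector. *)
Lemma corner_trace0_nilpotent i (y : 'M[K]_n.+1) :
  in_span L b f y -> e i * y = y -> y * e i = y -> \tr y = 0 ->
  exists k, y ^+ k = 0.
Proof.
move=> Ty ey ye try.
have [chi|[E [g [x [x0 /eigenvalueP[v vy v0]]]]]] := nilpotent_or_eigenvalue y.
  by exists n.+1; rewrite -[RHS](Cayley_Hamilton y) chi rmorphXn /= horner_mx_X.
have max' := map_maximal_system g max_e.
pose e' := map_mx g (e i); pose y' := map_mx g y; pose u := y' - x *: e'.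
have e'e' : e' * e' = e' by rewrite /e' -[_ * _]map_mxM [_ *m _]ee.
have Tu : in_span L b (g \o f) u.
  rewrite /u -scaleNr; apply: (span_add); first exact: map_span.
  by apply: span_scale; apply: map_span.
have e'y : e' * y' = y' by rewrite -[_ * _]map_mxM [_ *m _]ey.
have y'e : y' * e' = y' by rewrite -[_ * _]map_mxM [_ *m _]ye.
have eu : e' * u = u by rewrite mulrBr e'y -scalerAr e'e'.
have ue : u * e' = u by rewrite mulrBl y'e -scalerAl e'e'.
have [[k uk]|[t [_ ut]]] := corner_dichotomy max' Tu eu ue.
  have := mxtrace_nilpotent uk; rewrite /u raddfB /= mxtraceZ trace_map_mx try.
  rewrite rmorph0 sub0r => /eqP; rewrite oppr_eq0 mulf_eq0 (negPf x0) /=.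
  by rewrite (negPf (corner_trace_neq0 max' i)).
(* As x <> 0, the eigenvector v lies in the image of y', on which e' acts as the identity. *)
have ve : v *m e' = v.
  apply: (scalerI x0); rewrite scalemxAl -vy -mulmxA.
  by rewrite -[X in _ *m X]/(y' * e') y'e.
have vu : v *m u = 0 by rewrite mulmxBr vy -scalemxAr ve subrr.
have := congr1 (mulmx v) ut; rewrite -[X in _ *m X = _]/(u *m t) mulmxA vu mul0mx.
by rewrite ve => /esym/eqP; rewrite (negPf v0).
Qed.

(** It suffices that tr(y x) = tr(y e_i x e_i) vanishes for all x. If y e_i x e_i is nilpotent this
    is clear; otherwise y has a right inverse s in the corner, and y^j s^j = e_i for j > 0
    contradicts nilpotency. *)
Lemma corner_nilpotent_eq0 i (y : 'M[K]_n.+1) k :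
  in_span L b f y -> e i * y = y -> y * e i = y -> y ^+ k = 0 -> y = 0.
Proof.
move=> Ty ey ye yk; apply: (span_nondegenerate casS Ty) => x Tx.
pose u := y * (e i * x * e i).
have Tu : in_span L b f u by do 3!apply: (span_mul casS) => //.
have eu : e i * u = u by rewrite /u mulrA ey.
have ue : u * e i = u by rewrite /u -!mulrA ee.
have <- : \tr u = \tr (y * x).
  by rewrite /u !mulrA ye [LHS]mxtrace_mulC -[_ *m _]/(e i * (y * x)) mulrA ey.
have [[j uj]|[t [_ ut]]] := corner_dichotomy max_e Tu eu ue.
  exact: mxtrace_nilpotent uj.
pose s := e i * x * e i * t; have ys : y * s = e i by rewrite /s mulrA.
have yje j : y ^+ j.+1 * e i = y ^+ j.+1 by rewrite exprSr -mulrA ye.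
have ysj j : y ^+ j.+1 * s ^+ j.+1 = e i.
  elim: j => [|j IHj]; first by rewrite !expr1.
  by rewrite exprSr [s ^+ _]exprS mulrA -[_ * y * s]mulrA ys yje.
by have := ysj k; rewrite exprS yk mulr0 mul0r => /esym/eqP; rewrite (negPf (e0 i)).
Qed.

(** The corners are split: the scalar is chosen so that the difference has trace 0, hence is
    nilpotent, hence zero. *)
Lemma corner_scalar i x : in_span L b f x ->
  e i * x * e i = (\tr (e i * x) / \tr (e i)) *: e i.
Proof.
move=> Tx; apply/eqP; rewrite -subr_eq0; apply/eqP; set l := _ / _.
have tr0 := corner_trace_neq0 max_e i.
pose y := e i * x * e i - l *: e i; rewrite -/y.
have Ty : in_span L b f y.
  rewrite /y -scaleNr; apply: span_add; last exact: span_scale.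
  by do 2!apply: (span_mul casS) => //.
have ey : e i * y = y by rewrite {1}/y mulrBr !mulrA ee -scalerAr ee.
have ye : y * e i = y by rewrite {1}/y mulrBl -[_ * _ * e i * e i]mulrA ee -scalerAl ee.
have [|k yk] := corner_trace0_nilpotent Ty ey ye.
  rewrite /y raddfB /= mxtraceZ [\tr (_ * e i)]mxtrace_mulC.
  by rewrite -[_ *m _]/(e i * (e i * x)) mulrA ee /l divfK // subrr.
exact: (corner_nilpotent_eq0 Ty ey ye yk).
Qed.

End CornerScalars.

End MaximalSystem.

(** * The degree of a splitting *)

Section SplitRepresentation.

Variables (F : fieldType) (S : falgType F) (n m p : nat).
Variable L : {lrmorphism S -> 'M[F]_n.+1}.
Variables (b c : 'I_m -> S) (z w : 'I_p -> S).
Hypothesis chF : [pchar F] =i pred0.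
Hypothesis primeS : prime_ring S.
Hypothesis casS : casimir_data L b c z w.

(** The left side is central, so it expands in the w_l; its coefficients reduce by cyclicity and
    sum_k c_k b_k = 1. *)
Lemma casimir_projection y :
  \sum_k b k * y * c k = \sum_l \tr (L (y * z l)) *: w l.
Proof.
rewrite {1}(center_dual casS (casimir_central casS y)); apply: eq_bigr => l _.
congr (_ *: _); rewrite mulr_suml trL_sum -[y in RHS]mulr1 -(casimir_r casS).
rewrite mulr_sumr mulr_suml trL_sum; apply: eq_bigr => k _.
by rewrite -!mulrA trLC -!mulrA (center_z casS).
Qed.

Variables (K : fieldType) (f : {rmorphism F -> K}).
Variables (r : nat) (e : 'I_r -> 'M[K]_n.+1).
Hypothesis max_e : maximal_system L b f e.

Local Notation ext_rep := (ext_rep L f).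
Local Notation in_span := (in_span L b f).
Local Notation D i := (\tr (e i)).

Let Te i : in_span (e i). Proof. by case: max_e => -[]. Qed.
Let e0 i : e i != 0. Proof. by case: max_e => -[]. Qed.
Let ee i j : e i * e j = if i == j then e i else 0.
Proof. by case: max_e => -[]. Qed.
Let eii i : e i * e i = e i. Proof. by rewrite ee eqxx. Qed.
Let e1 : \sum_i e i = 1. Proof. by case: max_e => -[]. Qed.
Let D0 i : D i != 0. Proof. exact: (corner_trace_neq0 chF max_e). Qed.
Let eTe i x : in_span x -> e i * x * e i = (\tr (e i * x) / D i) *: e i.
Proof. exact: (corner_scalar chF casS max_e). Qed.

Lemma ext_rep_central s x : (forall t, t * s = s * t) -> in_span x ->
  ext_rep s * x = x * ext_rep s.
Proof.
move=> cs [u ->]; rewrite mulr_sumr mulr_suml; apply: eq_bigr => k _.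
by rewrite -scalerAr -scalerAl -!ext_repM cs.
Qed.

Lemma casimir_projection_span x : in_span x ->
  \sum_k ext_rep (b k) * x * ext_rep (c k) = \sum_l \tr (x * ext_rep (z l)) *: ext_rep (w l).
Proof.
case=> u ->.
transitivity (\sum_j u j *: ext_rep (\sum_k b k * b j * c k)).
  under [RHS]eq_bigr do rewrite ext_rep_sum scaler_sumr.
  rewrite exchange_big; apply: eq_bigr => k _ /=.
  rewrite mulr_sumr mulr_suml; apply: eq_bigr => j _.
  by rewrite -scalerAr -scalerAl -!ext_repM.
under eq_bigr do rewrite casimir_projection ext_rep_sum scaler_sumr.
rewrite exchange_big; apply: eq_bigr => l _ /=.
rewrite mulr_suml raddf_sum scaler_suml; apply: eq_bigr => j _ /=.
by rewrite -scalerAl mxtraceZ -scalerA ext_repZ -ext_repM mxtrace_ext_rep.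
Qed.

(** The element e_i (sum_k b_k e_i c_k) e_i is computed twice. Since corners are scalar, it is D^-2
    sum_k tr(e_i b_k) tr(e_i c_k) e_i = D^-1 e_i, with D = tr(e_i). By the projection formula it is
    sum_l tr(e_i z_l) w_l e_i, that is D W e_i with W = sum_l z_l w_l, as tr(e_i z_l) e_i = D z_l
    e_i. *)
Lemma central_casimir_idempotent i :
  ext_rep (\sum_l z l * w l) * e i = ((D i)^-1 ^+ 2) *: e i.
Proof.
have eCe : e i * (\sum_k ext_rep (b k) * e i * ext_rep (c k)) * e i = (D i)^-1 *: e i.
  transitivity ((\sum_k \tr (e i * ext_rep (b k)) * \tr (e i * ext_rep (c k)))
      *: ((D i)^-1 ^+ 2 *: e i)).
    rewrite mulr_sumr mulr_suml scaler_suml; apply: eq_bigr => k _.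
    rewrite -{2}(eii i) -[LHS]mulrA.
    transitivity ((e i * ext_rep (b k) * e i) * (e i * ext_rep (c k) * e i)).
      by rewrite !mulrA.
    rewrite !eTe; try exact: (span_ext_rep casS).
    by rewrite -scalerAl -scalerAr eii !scalerA; congr (_ *: _); rewrite expr2; ring.
  suff -> : \sum_k \tr (e i * ext_rep (b k)) * \tr (e i * ext_rep (c k)) = D i.
    by rewrite scalerA expr2 mulVKf.
  transitivity (\tr (e i * \sum_k \tr (e i * ext_rep (b k)) *: ext_rep (c k))).
    rewrite mulr_sumr raddf_sum.
    by apply: eq_bigr => k _ /=; rewrite -scalerAr mxtraceZ.
  by rewrite -(span_expand casS) // eii.
rewrite ext_rep_sum mulr_suml expr2 -scalerA -eCe casimir_projection_span //.
rewrite mulr_sumr mulr_suml scaler_sumr; apply: eq_bigr => l _.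
have cz := ext_rep_central (center_z casS l); have cw := ext_rep_central (center_w casS l).
rewrite -scalerAr -scalerAl scalerA.
have -> : e i * ext_rep (w l) * e i = ext_rep (w l) * e i by rewrite -cw // -mulrA eii.
have -> : ext_rep (z l * w l) * e i = ext_rep (w l) * (e i * ext_rep (z l) * e i).
  by rewrite -(center_z casS) ext_repM -mulrA -cz // -mulrA eii.
rewrite eTe; last exact: (span_ext_rep casS).
by rewrite -scalerAr mulrC.
Qed.

(** In finite dimension s is either invertible, which would force e_i = 0, or a zero divisor; a
    central zero divisor in a prime ring is 0. *)
Lemma central_ext_rep_eq0 s (i : 'I_r) :
  (forall t, t * s = s * t) -> ext_rep s * e i = 0 -> s = 0.
Proof.
move=> cs sei; have [ker0|] := boolP (lker (amull s) == 0%VS).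
  have [t st] : exists t, s * t = 1.
    by exists ((amull s)^-1%VF 1); have := lker0_lfunVK ker0 1; rewrite lfunE.
  have := e0 i; rewrite -[e i]mul1r -(ext_rep1 L f) -st -cs ext_repM -mulrA sei mulr0.
  by rewrite eqxx.
rewrite -subv0 => /subvPn[t]; rewrite memv_ker lfunE memv0 /= => /eqP st t0.
have [|//|/eqP] := primeS.2 s t; last by rewrite (negPf t0).
by move=> u; rewrite -cs -mulrA st mulr0.
Qed.

Lemma split_degree : exists d : nat,
  [/\ (0 < d)%N, forall i, D i = d%:R, n.+1 = (d ^ 2 * p)%N & r = (d * p)%N].
Proof.
have chK := pchar0_morph f chF.
have natF k : (k%:R == 0 :> F) = (k == 0)%N := (pcharf0P F).1 chF k.
(* Ranks replace the traces so that the scalar q_i^-2 already lies in F and W can be compared with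
   it in S. *)
pose q i := \rank (e i).
have Dq i : D i = (q i)%:R by exact: mxtrace_idempotent (eii i).
have q0 i : (q i != 0)%N by rewrite mxrank_eq0.
pose W := \sum_l z l * w l.
have Wq i : W = ((q i)%:R^-1 ^+ 2)%:A.
  apply/eqP; rewrite -subr_eq0; apply/eqP; apply: (@central_ext_rep_eq0 _ i).
    move=> t; rewrite mulrBr mulrBl -scalerAr -scalerAl mulr1 mul1r; congr (_ - _).
    rewrite mulr_sumr mulr_suml; apply: eq_bigr => l _.
    by rewrite mulrA (center_z casS) -!mulrA (center_w casS).
  rewrite ext_repB mulrBl central_casimir_idempotent ext_repZ ext_rep1 -scalerAl mul1r.
  by rewrite Dq rmorphXn fmorphV rmorph_nat subrr.
(* The trace of W is p by duality of z and w, and (n + 1) q_i^-2 because W is scalar. Hence all the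
   q_i agree. *)
have trW i : (n.+1 = q i ^ 2 * p)%N.
  have : \tr (L W) = p%:R.
    rewrite trL_sum; under eq_bigr do rewrite (center_trace casS).
    by rewrite sumr_const card_ord.
  rewrite (Wq i) trLZ rmorph1 mxtrace1 => /(congr1 ( *%R ((q i)%:R ^+ 2))).
  have nz : (q i)%:R ^+ 2 != 0 :> F by rewrite expf_neq0 // natF.
  rewrite mulrA -exprMn divff ?natF // expr1n mul1r -natrX -natrM.
  exact: pchar0_natr_inj.
have sum_q : (\sum_i q i = n.+1)%N.
  apply: (pchar0_natr_inj chK); rewrite natr_sum -[RHS]mxtrace1.
  rewrite -[1%:M]/(1 : 'M[K]_n.+1) -e1 raddf_sum.
  by apply: eq_bigr => i _ /=; rewrite Dq.
case: (pickP (@predT 'I_r)) => [i0 _|no]; last by move: sum_q; rewrite big_pred0.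
have p_gt0 : (0 < p)%N by have := trW i0; case: (p) => //; rewrite muln0.
have qE i : q i = q i0.
  have := trW i; rewrite {1}(trW i0) => /eqP.
  by rewrite eqn_pmul2r // eqn_exp2r // => /eqP.
exists (q i0); split=> // [|i|].
- by rewrite lt0n.
- by rewrite Dq qE.
have := sum_q; rewrite (trW i0); under eq_bigr do rewrite qE.
rewrite sum_nat_const card_ord expnS expn1 -mulnA [(r * _)%N]mulnC => /eqP.
by rewrite eqn_pmul2l ?lt0n // => /eqP.
Qed.

End SplitRepresentation.

(** * Matrix units and the splitting representation *)

Section MatrixUnits.

Variables (F : fieldType) (S : falgType F) (n m p : nat).
Variable L : {lrmorphism S -> 'M[F]_n.+1}.
Variables (b c : 'I_m -> S) (z w : 'I_p -> S).
Hypothesis chF : [pchar F] =i pred0.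
Hypothesis L_inj : injective L.
Hypothesis casS : casimir_data L b c z w.

Variables (K : fieldType) (f : {rmorphism F -> K}).
Variables (r : nat) (e : 'I_r -> 'M[K]_n.+1).
Hypothesis max_e : maximal_system L b f e.

Local Notation ext_rep := (ext_rep L f).
Local Notation in_span := (in_span L b f).
Local Notation D i := (\tr (e i)).

Let Te i : in_span (e i). Proof. by case: max_e => -[]. Qed.
Let e0 i : e i != 0. Proof. by case: max_e => -[]. Qed.
Let ee i j : e i * e j = if i == j then e i else 0.
Proof. by case: max_e => -[]. Qed.
Let eii i : e i * e i = e i. Proof. by rewrite ee eqxx. Qed.
Let e1 : \sum_i e i = 1. Proof. by case: max_e => -[]. Qed.
Let D0 i : D i != 0. Proof. exact: (corner_trace_neq0 chF max_e). Qed.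
Let eTe i x : in_span x -> e i * x * e i = (\tr (e i * x) / D i) *: e i.
Proof. exact: (corner_scalar chF casS max_e). Qed.
Let TM x y : in_span x -> in_span y -> in_span (x * y).
Proof. exact: (span_mul casS). Qed.

(** Linked idempotents lie in the same block of the span; testing on the finite family b makes the
    relation boolean. *)
Let linked i j : bool := [exists k, e i * ext_rep (b k) * e j != 0].

Let unlinkedP i j x : ~~ linked i j -> in_span x -> e i * x * e j = 0.
Proof.
rewrite negb_exists => /forallP no [u ->]; rewrite mulr_sumr mulr_suml big1 // => k _.
by have := no k; rewrite negbK -scalerAr -scalerAl => /eqP ->; rewrite scaler0.
Qed.

(** For u <> 0 in e_i T e_j, where T is the span, nondegeneracy gives x with tr(u x) <> 0, and a
    multiple v of e_j x e_i satisfies u v = e_i. Then v u is a scalar multiple of e_j, and u v u = u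
    makes the scalar 1. *)
Let linkedP i j : linked i j -> exists uv : 'M[K]_n.+1 * 'M[K]_n.+1,
  [/\ in_span uv.1, in_span uv.2, e i * uv.1 * e j = uv.1,
      e j * uv.2 * e i = uv.2 & uv.1 * uv.2 = e i /\ uv.2 * uv.1 = e j].
Proof.
case/existsP=> k; set u := _ * _ * _ => u0.
have Tu : in_span u by do 2!apply: TM => //; apply: (span_ext_rep casS).
have eu : e i * u = u by rewrite /u !mulrA eii.
have ue : u * e j = u by rewrite /u -mulrA eii.
have [x [Tx trux]] : exists x, in_span x /\ \tr (u * x) <> 0.
  apply: NNPP => no; move/eqP: u0; apply; apply: (span_nondegenerate casS Tu).
  by move=> x Tx; apply: NNPP => trux; apply: no; exists x.
pose l := \tr (u * x) / D i.
have l0 : l != 0 by rewrite mulf_neq0 ?invr_eq0 //; apply/eqP.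
pose v := l^-1 *: (e j * x * e i).
have Tv : in_span v by apply/span_scale/TM/Te/TM.
have ev : e j * v = v by rewrite /v -scalerAr !mulrA eii.
have ve : v * e i = v by rewrite /v -scalerAl -[_ * e i * e i]mulrA eii.
have uv : u * v = e i.
  rewrite /v -scalerAr !mulrA ue -{1}eu -[e i * u * x]mulrA eTe; last exact: TM.
  by rewrite mulrA eu scalerA mulVf // scale1r.
have [t vuE] : exists t, v * u = t *: e j.
  have Tvu : in_span (v * u) by apply: TM.
  by exists (\tr (e j * (v * u)) / D j); rewrite -(eTe _ Tvu) [e j * (v * u)]mulrA ev -[v * u * e j]mulrA ue.
have t1 : t = 1.
  have : u * (v * u) = u by rewrite [u * (v * u)]mulrA uv eu.
  rewrite vuE -scalerAr ue -[RHS]scale1r => /eqP; rewrite -subr_eq0 -scalerBl.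
  by rewrite scaler_eq0 (negPf u0) orbF subr_eq0 => /eqP.
by exists (u, v); split=> //=; rewrite ?eu ?ev // vuE t1 scale1r.
Qed.

Let linkedI i j u v : in_span u -> e i * u * e j = u -> u * v = e i -> linked i j.
Proof.
move=> Tu eue uv; apply: contraT => nl; have := e0 i.
by rewrite -uv -eue unlinkedP // mul0r eqxx.
Qed.

Let linked_refl i : linked i i.
Proof. by apply: (@linkedI i i (e i) (e i)); rewrite ?eii. Qed.

Let linked_sym i j : linked i j -> linked j i.
Proof.
by case/linkedP=> -[u v] /= [_ Tv _ ev [_ vu]]; apply: (linkedI Tv ev vu).
Qed.

Let linked_trans i j k : linked i j -> linked j k -> linked i k.
Proof.
case/linkedP=> -[u v] /= [Tu Tv eu ev [uv _]].
case/linkedP=> -[u' v'] /= [Tu' Tv' eu' ev' [uv' _]].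
have eui : e i * u = u by rewrite -eu !mulrA eii.
have uej : u * e j = u by rewrite -eu -mulrA eii.
have uek : u' * e k = u' by rewrite -eu' -mulrA eii.
apply: (@linkedI i k (u * u') (v' * v)); first exact: TM.
  by rewrite mulrA eui -mulrA uek.
by rewrite mulrA -[u * u' * v']mulrA uv' uej.
Qed.

(** A canonical index in each block: [pick] depends only on the predicate, so linked indices receive
    the same choice. *)
Let repr i := odflt i [pick j | linked j i].

Let repr_linked i : linked (repr i) i.
Proof.
by rewrite /repr; case: pickP => [j //|/(_ i)]; rewrite linked_refl.
Qed.

Let repr_eq i j : linked i j -> repr i = repr j.
Proof.
move=> lij; have eqij : (linked^~ i) =1 (linked^~ j).
  move=> k; apply/idP/idP=> lk; first exact: linked_trans lk lij.
  exact: linked_trans lk (linked_sym lij).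
rewrite /repr (eq_pick eqij); case: pickP => // /(_ j).
by rewrite linked_refl.
Qed.

(** Matrix units u_i, v_i join e_i to the representative of its block, and u_i x v_j = rho(x)_ij
    e_(repr i), which is zero across distinct blocks. Thus rho is the sum of one matrix
    representation per block. *)
Lemma matrix_representation (d : nat) : (forall i, D i = d%:R) ->
  exists rho : S -> 'M[K]_r,
  [/\ forall k x y, rho (k *: x + y) = f k *: rho x + rho y,
      forall x y, rho (x * y) = rho x *m rho y, rho 1 = 1%:M,
      injective rho & forall x, d%:R * \tr (rho x) = f (\tr (L x))].
Proof.
move=> Dd; have /fin_all_exists[uv uvP] := fun i => linkedP (repr_linked i).
pose u i := (uv i).1; pose v i := (uv i).2.
have Tu i : in_span (u i) by case: (uvP i).
have Tv i : in_span (v i) by case: (uvP i).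
have eu i : e (repr i) * u i = u i.
  by case: (uvP i) => _ _ E _ _; rewrite -{1}[u i]E !mulrA eii E.
have ve i : v i * e (repr i) = v i.
  by case: (uvP i) => _ _ _ E _; rewrite -{1}[v i]E -mulrA eii E.
have ue i : u i * e i = u i.
  by case: (uvP i) => _ _ E _ _; rewrite -{1}[u i]E -mulrA eii E.
have ev i : e i * v i = v i.
  by case: (uvP i) => _ _ _ E _; rewrite -{1}[v i]E !mulrA eii E.
have uvE i : u i * v i = e (repr i) by case: (uvP i) => _ _ _ _ [].
have vuE i : v i * u i = e i by case: (uvP i) => _ _ _ _ [].
have d0 (i : 'I_r) : (d%:R : K) != 0 by rewrite -(Dd i).
have uxv0 i j x : repr i != repr j -> in_span x -> u i * x * v j = 0.
  move=> rij Tx; rewrite -(eu i) -(ve j) -[e _ * _ * _]mulrA.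
  rewrite [_ * (v j * _)]mulrA -[e _ * _ * v j]mulrA.
  apply: unlinkedP; last exact/TM/Tv/TM.
  apply: contra rij => l; apply/eqP/repr_eq.
  apply: linked_trans (linked_trans _ l) (repr_linked j).
  exact/linked_sym/repr_linked.
have uxv i j x : in_span x ->
    u i * x * v j = (\tr (u i * x * v j) / d%:R) *: e (repr i).
  move=> Tx; have [rij|rij] := eqVneq (repr i) (repr j); last first.
    by rewrite uxv0 // mxtrace0 mul0r scale0r.
  set y := u i * x * v j; have Ty : in_span y by apply/TM/Tv/TM.
  have ey : e (repr i) * y = y by rewrite /y !mulrA eu.
  have ye : y * e (repr j) = y by rewrite /y -mulrA ve.
  by rewrite -{1}ye -rij -{1}ey eTe // ey Dd.
pose rho x : 'M[K]_r := \matrix_(i, j) (\tr (u i * ext_rep x * v j) / d%:R).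
have uxvE i j x : u i * ext_rep x * v j = rho x i j *: e (repr i).
  by rewrite mxE -uxv //; apply: (span_ext_rep casS).
have rho_lin k x y : rho (k *: x + y) = f k *: rho x + rho y.
  apply/matrixP=> i j; rewrite !mxE /ext_rep linearP map_mxD map_mxZ.
  by rewrite mulrDr mulrDl -scalerAr -scalerAl raddfD /= mxtraceZ mulrDl mulrA.
exists rho; split=> // [x y||x y Exy|x].
- apply/matrixP=> i j; rewrite [RHS]mxE [LHS]mxE; apply: (mulIf (d0 i)); rewrite divfK ?(d0 i) //.
  rewrite ext_repM -[ext_rep x]mulr1 -e1 !(mulr_sumr, mulr_suml) raddf_sum.
  apply: eq_bigr => k _ /=; rewrite -vuE.
  transitivity (\tr ((u i * ext_rep x * v k) * (u k * ext_rep y * v j))).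
    by rewrite !mulrA.
  rewrite !uxvE -scalerAl -scalerAr !mxtraceZ ee.
  have [rik|rik] := eqVneq; first by rewrite Dd mulrA.
  by rewrite mxtrace0 !mulr0 mxE uxv0 ?mxtrace0 ?mul0r //; apply: (span_ext_rep casS).
- apply/matrixP=> i j; rewrite !mxE ext_rep1 mulr1 -(ue i) -(ev j).
  rewrite -mulrA [e i * _]mulrA ee; case: eqVneq => [->|_].
    by rewrite ev uvE Dd divff ?d0.
  by rewrite mul0r mulr0 mxtrace0 mul0r.
- have liftE t : ext_rep t = \sum_i \sum_j v i * (rho t i j *: e (repr i)) * u j.
    rewrite -[LHS]mul1r -[LHS]mulr1 -e1 !mulr_suml; apply: eq_bigr => i _.
    rewrite mulr_sumr; apply: eq_bigr => j _.
    by rewrite -uxvE !mulrA vuE -!mulrA vuE.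
  by apply/L_inj/(map_mx_inj (f := f)); rewrite -![map_mx f _]/(ext_rep _) !liftE Exy.
(* Each diagonal entry satisfies d rho(x)_ii = tr(u_i x v_i) = tr(x e_i), and these sum to tr x. *)
have -> : f (\tr (L x)) = \sum_i \tr (ext_rep x * e i).
  by rewrite -raddf_sum -mulr_sumr e1 mulr1 /= mxtrace_ext_rep.
rewrite [\tr (rho x)]/mxtrace mulr_sumr.
apply: eq_bigr => i _ /=; rewrite mxE mulrC divfK ?d0 // [LHS]mxtrace_mulC.
by rewrite -[v i *m _]/(v i * (u i * ext_rep x)) mulrA vuE [RHS]mxtrace_mulC.
Qed.

End MatrixUnits.

(** * The reduced representation and integrality *)

(** From dim S = d^2 p the square root in [deg_center] is exactly d, so the size r = d p of the
    splitting representation is the degree, and its trace is the regular trace divided by d. *)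
Lemma reduced_representation (F : fieldType) (S : falgType F) :
  [pchar F] =i pred0 -> prime_ring S ->
  exists (K : fieldType) (f : {rmorphism F -> K}) (rho : S -> 'M[K]_(rdegree S)),
  [/\ forall k x y, rho (k *: x + y) = f k *: rho x + rho y,
      forall x y, rho (x * y) = rho x *m rho y, rho 1 = 1%:M,
      injective rho & forall x, \tr (rho x) = f (reduced_trace x)].
Proof.
move=> chF primeS; have [n [dimS [L [L_inj trL [e e_basis trE]]]]] := falg_regular S.
have [c [z [w casS]]] := casimir_exists chF primeS L_inj e_basis trE.
have [K [f [r [E max_e]]]] := maximal_system_exists chF casS.
have [d [d_gt0 Dd nE rE]] := split_degree chF primeS casS max_e.
have p_gt0 : (0 < \dim 'Z({:S})%VS)%N by case: (\dim _) nE => //; rewrite muln0.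
have deg_d : deg_center S = d.
  by rewrite /deg_center dimS nE mulnK // -mulnn PeanoNat.Nat.sqrt_square.
have -> : rdegree S = r by rewrite /rdegree deg_d.
have [rho [lin mul one inj tr]] := matrix_representation chF L_inj casS max_e Dd.
exists K, f, rho; split=> // x; have chK := pchar0_morph f chF.
rewrite /reduced_trace deg_d -trL rmorphM fmorphV rmorph_nat -tr mulKf //.
by rewrite (pcharf0P _).1 // -lt0n.
Qed.

Lemma size_ncoefs (K : fieldType) (p : nat -> K) (n : nat) : size (ncoefs p n) = n.+1.
Proof. by elim: n => //= n IHn; rewrite size_rcons IHn. Qed.

Lemma map_ncoefs (F K : fieldType) (f : {rmorphism F -> K}) (p : nat -> F) (n : nat) :
  map f (ncoefs p n) = ncoefs (f \o p) n.
Proof.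
elim: n => [|n IHn] /=; first by rewrite rmorph1.
rewrite map_rcons IHn; congr rcons.
rewrite rmorphM rmorphN fmorphV rmorph_nat rmorph_sum; congr (_ * _).
apply: eq_bigr => j _; rewrite rmorphM -IHn (nth_map 0) //.
by rewrite size_ncoefs ltnS leq_subr.
Qed.

Lemma eq_ncoefs (K : fieldType) (p q : nat -> K) (n : nat) :
  p =1 q -> ncoefs p n = ncoefs q n.
Proof.
move=> pq; elim: n => //= n ->; congr rcons; congr (_ * _).
by apply: eq_bigr => j _; rewrite pq.
Qed.

Lemma ncoefs_mxtrace_map (F K : fieldType) (f : {rmorphism F -> K}) (n : nat)
    (M : 'M[K]_n) (t : nat -> F) (i : nat) :
  [pchar F] =i pred0 -> (forall j, f (t j) = \tr (M ^+ j)) -> (i <= n)%N ->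
  f (ncoefs t n)`_i = (char_poly M)`_(n - i).
Proof.
move=> chF tM lein; rewrite -ncoefs_mxtrace //; last exact: pchar0_morph f chF.
have -> : ncoefs (fun j => \tr (M ^+ j)) n = map f (ncoefs t n).
  by rewrite map_ncoefs; apply: eq_ncoefs => j; rewrite -tM.
by rewrite (nth_map 0) // size_ncoefs.
Qed.

Lemma Cayley_Hamilton_rev (K : fieldType) (n : nat) (M : 'M[K]_n) :
  M ^+ n + \sum_(i < n) (char_poly M)`_(n - i.+1) *: M ^+ (n - i.+1) = 0.
Proof.
case: n M => [|n] M; first by rewrite [LHS]flatmx0 flatmx0.
rewrite -[RHS](Cayley_Hamilton M) horner_mx_coef size_char_poly [RHS]big_ord_recr /=.
have /monicP := char_poly_monic M; rewrite lead_coefE size_char_poly /= => ->.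
rewrite scale1r addrC; congr (_ + _); rewrite (reindex_inj rev_ord_inj) /=.
by apply: eq_bigr => i _; rewrite subSS subKn // -ltnS.
Qed.

Lemma coef_prod_XsubC_integral (A : comNzRingType) (E : fieldType)
    (g : {rmorphism A -> E}) (s : seq E) :
  (forall x, x \in s -> integralOver g x) ->
  forall i, integralOver g (\prod_(x <- s) ('X - x%:P))`_i.
Proof.
elim: s => [_ i|x s IHs ints i].
  by rewrite big_nil coef1; apply: integral_nat.
have {}IHs := IHs (fun y ys => ints y (mem_behead (s := x :: s) ys)).
rewrite big_cons mulrBl coefB coefXM coefCM; apply: integral_sub.
  by case: eqP => _; [apply: integral0 | apply: IHs].
by apply: integral_mul => //; apply/ints/mem_head.
Qed.

(** The minimal polynomial of M divides the image of q, so the eigenvalues are integral; in a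
    splitting field the coefficients of chi are polynomials in them. *)
Lemma char_poly_integral (A : comNzRingType) (K : fieldType)
    (g : {rmorphism A -> K}) (n : nat) (M : 'M[K]_n.+1) (q : {poly A}) :
  q \is monic -> horner_mx M (map_poly g q) = 0 ->
  exists (E : fieldType) (h : {rmorphism K -> E}),
  forall i, integralOver (h \o g) (h (char_poly M)`_i).
Proof.
move=> q_mon qM; have [E [h [s Ds]]] := extension_split (char_poly_monic M).
exists E, h => i; rewrite -coef_map Ds.
apply: (@coef_prod_XsubC_integral _ _ (h \o g)) => x xs; exists q => //.
have : root (map_poly h (char_poly M)) x by rewrite Ds root_prod_XsubC.
rewrite map_char_poly -eigenvalue_root_char eigenvalue_root_min.
apply: root_dvdp; rewrite dvd_mxminpoly map_poly_comp -map_horner_mx qM.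
by rewrite map_mx0.
Qed.

Lemma integrally_closed_descent (A : idomainType) (E : fieldType)
    (h : {rmorphism {fraction A} -> E}) (x : {fraction A}) :
  integrally_closed A -> integralOver (h \o @FracField.tofrac A) (h x) ->
  exists a : A, x = a%:F.
Proof.
move=> icA [q q_mon]; rewrite map_poly_comp fmorph_root => qx.
by apply: icA; exists q.
Qed.

(** The determinant trick: Cayley-Hamilton for the matrix B of left multiplication by r on the
    generators shows that chi_B(r) kills each of them, hence kills 1. *)
Lemma fin_gen_integral (A : comNzRingType) (R : algType A) (r : R) :
  fin_gen_module R ->
  exists q : {poly A}, q \is monic /\ \sum_(i < size q) q`_i *: r ^+ i = 0.
Proof.
case=> s gen; have [k [g {}gen]] : exists k (g : 'I_k -> R),
    forall x, exists u : 'I_k -> A, x = \sum_i u i *: g i.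
  by exists (size s), (fun i => s`_i).
(* Without generators R is zero and the polynomial 1 will do. *)
case: k g gen => [|k] g gen.
  have z x : x = 0 :> R by have [u ->] := gen x; rewrite big_ord0.
  by exists 1; split; [exact: monic1 | exact: z].
have /fin_all_exists[M rM] := fun i => gen (r * g i).
pose B := \matrix_(i, j) M i j; exists (char_poly B); split.
  exact: char_poly_monic.
have rB j i : r ^+ j * g i = \sum_l (B ^+ j) i l *: g l.
  elim: j => [|j IHj] in i *.
    rewrite expr0 mul1r (bigD1 i) //= big1 ?addr0 ?mxE ?eqxx ?scale1r // => l li.
    by rewrite mxE eq_sym (negPf li) scale0r.
  rewrite exprSr -mulrA rM mulr_sumr; under eq_bigr do rewrite -scalerAr IHj scaler_sumr.
  rewrite exchange_big; apply: eq_bigr => l _ /=; rewrite exprS mxE scaler_suml.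
  by apply: eq_bigr => t _; rewrite scalerA mxE.
set y := \sum_(_ < _) _; have yg i : y * g i = 0.
  transitivity (\sum_l (horner_mx B (char_poly B)) i l *: g l).
    rewrite horner_mx_coef mulr_suml.
    under eq_bigr do rewrite -scalerAl rB scaler_sumr.
    rewrite exchange_big; apply: eq_bigr => l _ /=; rewrite summxE scaler_suml.
    by apply: eq_bigr => t _; rewrite scalerA mxE.
  by rewrite Cayley_Hamilton big1 // => l _; rewrite mxE scale0r.
by rewrite -[y]mulr1; have [u ->] := gen 1; rewrite mulr_sumr big1 // => i _;
  rewrite -scalerAr yg scaler0.
Qed.

(** * Trace axioms and the Cayley-Hamilton identity over F *)

Section ReducedTrace.

Variables (F : fieldType) (S : falgType F).
Hypothesis chF : [pchar F] =i pred0.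
Variables (K : fieldType) (f : {rmorphism F -> K}) (rho : S -> 'M[K]_(rdegree S)).
Hypothesis rho_lin : forall k x y, rho (k *: x + y) = f k *: rho x + rho y.
Hypothesis rhoM : forall x y, rho (x * y) = rho x *m rho y.
Hypothesis rho1 : rho 1 = 1%:M.
Hypothesis rho_inj : injective rho.
Hypothesis tr_rho : forall x, \tr (rho x) = f (reduced_trace x).

Lemma rep0 : rho 0 = 0.
Proof. by have := rho_lin (-1) 0 0; rewrite scaler0 addr0 rmorphN1 scaleN1r addNr. Qed.

Lemma repX x j : rho (x ^+ j) = rho x ^+ j.
Proof. by elim: j => [|j IHj]; rewrite ?expr0 ?rho1 // !exprS rhoM IHj. Qed.

Lemma rep_sum (I : finType) (k : I -> F) (x : I -> S) :
  rho (\sum_i k i *: x i) = \sum_i f (k i) *: rho (x i).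
Proof.
by elim/big_rec2: _ => [|i y1 y2 _ <-]; [exact: rep0 | exact: rho_lin].
Qed.

Lemma reduced_trace_linear k (x y : S) :
  reduced_trace (k *: x + y) = k * reduced_trace x + reduced_trace y.
Proof.
apply: (fmorph_inj f).
by rewrite -tr_rho rho_lin mxtraceD mxtraceZ !tr_rho -rmorphM -rmorphD.
Qed.

Lemma reduced_traceC (x y : S) : reduced_trace (x * y) = reduced_trace (y * x).
Proof. by apply: (fmorph_inj f); rewrite -!tr_rho !rhoM mxtrace_mulC. Qed.

Lemma reduced_trace1 : reduced_trace (1 : S) = (rdegree S)%:R.
Proof. by apply: (fmorph_inj f); rewrite -tr_rho rho1 mxtrace1 rmorph_nat. Qed.

Lemma reduced_trace_trace_alg : trace_alg (@reduced_trace _ S).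
Proof.
split; first exact: reduced_trace_linear.
- by move=> a b; rewrite mulr_algl mulr_algr.
- exact: reduced_traceC.
move=> a b; rewrite mulr_algl -[_ *: b]addr0 reduced_trace_linear.
suff -> : reduced_trace (0 : S) = 0 by rewrite addr0.
by apply: (fmorph_inj f); rewrite -tr_rho rep0 mxtrace0 rmorph0.
Qed.

Lemma ncoefs_char_poly (a : S) i : (i <= rdegree S)%N ->
  f (ncoefs (fun j => reduced_trace (a ^+ j)) (rdegree S))`_i =
    (char_poly (rho a))`_(rdegree S - i).
Proof.
by apply: ncoefs_mxtrace_map => // j; rewrite -tr_rho repX.
Qed.

Lemma reduced_trace_CH (a : S) :
  a ^+ rdegree S + \sum_(i < rdegree S)
    (ncoefs (fun j => reduced_trace (a ^+ j)) (rdegree S))`_i.+1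
      *: a ^+ (rdegree S - i.+1) = 0.
Proof.
apply: rho_inj; rewrite -[a ^+ rdegree S]scale1r rho_lin rmorph1 scale1r repX.
rewrite rep_sum rep0 -[RHS](Cayley_Hamilton_rev (rho a)); congr (_ + _).
by apply: eq_bigr => i _; rewrite ncoefs_char_poly // repX.
Qed.

End ReducedTrace.

(** * Transfer between R and S *)

Lemma scalar_extension_prime (A : idomainType) (R : algType A)
    (S : falgType {fraction A}) (iota : {rmorphism R -> S}) :
  prime_ring R -> scalar_extension iota -> prime_ring S.
Proof.
move=> [_ primeR] [iotaZ iota_inj frac]; split=> [|x y xSy]; first exact: oner_neq0.
have [r [a [a0 Dx]]] := frac x; have [s [b [b0 Dy]]] := frac y.
have fr0 (t : A) : t != 0 -> (t%:F)^-1 != 0 by rewrite invr_eq0 tofrac_eq0.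
have [t||] := primeR r s.
- apply: iota_inj; rewrite !rmorphM rmorph0; have /eqP := xSy (iota t).
  rewrite Dx Dy -!(scalerAl, scalerAr) !scaler_eq0.
  by rewrite !(negPf (fr0 _ _)) //= => /eqP.
- by move=> r0; left; rewrite Dx r0 rmorph0 scaler0.
- by move=> s0; right; rewrite Dy s0 rmorph0 scaler0.
Qed.

Theorem theorem4p1 (A : idomainType) (R : algType A)
    (S : falgType {fraction A}) (iota : {rmorphism R -> S}) :
  integrally_closed A ->
  [pchar {fraction A}] =i pred0 ->
  injective (fun a : A => a%:A : R) ->
  prime_ring R ->
  fin_gen_module R ->
  scalar_extension iota ->
  exists tR : R -> A,
    (forall r : R, (tR r)%:F = reduced_trace (iota r)) /\
    n_CH_algebra (@FracField.tofrac A) tR (rdegree S) /\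
    n_CH_algebra id (@reduced_trace _ S) (rdegree S).
Proof.
move=> icA chF _ primeR finR extS.
have primeS := scalar_extension_prime primeR extS.
have [iotaZ iota_inj _] := extS.
have [K [f [rho [lin mul one inj tr]]]] := reduced_representation chF primeS.
have tS_alg := reduced_trace_trace_alg lin mul tr.
have tS1 := reduced_trace1 one tr.
have chiS := ncoefs_char_poly chF mul one tr.
have CHS := reduced_trace_CH chF lin mul one inj tr.
have [tS_lin _ tSC tSM] := tS_alg.
(* The coefficients of chi of rho(iota r) are integral over A since r is; those that come from F
   therefore lie in A. *)
have coef_in_A r i x : f x = (char_poly (rho (iota r)))`_i -> exists a : A, x = a%:F.
  move=> fx; have [q [q_mon qr]] := fin_gen_integral r finR.
  pose g := f \o @FracField.tofrac A.
  have [E [h int_h]] : exists (E : fieldType) (h : {rmorphism K -> E}),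
      integralOver (h \o g) (h (char_poly (rho (iota r)))`_i).
    have : \sum_(j < size q) g q`_j *: rho (iota r) ^+ j = 0.
      have := congr1 (rho \o iota) qr; rewrite /= rmorph0 (rep0 lin) => qr0.
      rewrite -[RHS]qr0 rmorph_sum; under [in RHS]eq_bigr do rewrite iotaZ rmorphXn.
      by rewrite (rep_sum lin); apply: eq_bigr => j _; rewrite (repX mul one).
    (* In size 0 the characteristic polynomial is 1, whose coefficients are trivially integral. *)
    case: (rdegree S) (rho (iota r)) => [|n] M qM.
      exists K, idfun; rewrite /char_poly det_mx00 coef1 /=; exact: integral_nat.
    have [|E [h int_h]] := @char_poly_integral _ _ g _ M _ q_mon; last by exists E, h.
    rewrite horner_mx_coef size_map_poly_id0; last by rewrite (monicP q_mon) rmorph1 oner_neq0.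
    by rewrite -[RHS]qM; apply: eq_bigr => j _; rewrite coef_map.
  apply: (@integrally_closed_descent _ _ (h \o f)) => //.
  by rewrite /= fx.
have [tR tRE] : exists tR : R -> A, forall r, (tR r)%:F = reduced_trace (iota r).
  have ex r : exists a : A, a%:F = reduced_trace (iota r).
    have [n0|n_gt0] := posnP (rdegree S).
      exists 0; apply: (fmorph_inj f); rewrite -tr rmorph0; move: (rho _).
      by rewrite n0 => M; rewrite [M]flatmx0 mxtrace0.
    (* The trace is minus the coefficient of degree n - 1, which exists because n > 0. *)
    have [|a Ea] := @coef_in_A r (rdegree S).-1 (- reduced_trace (iota r)).
      by rewrite rmorphN -tr char_poly_trace.
    by exists (- a); rewrite rmorphN /= -Ea opprK.
  by exists (fun r => sval (sig_eqW (ex r))) => r; case: sig_eqW.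
have F_inj : injective (@FracField.tofrac A) by move=> x y /eqP; rewrite tofrac_eq => /eqP.
exists tR; split=> //; split; last first.
  split=> // a; exists (fun i => (ncoefs (fun j => reduced_trace (a ^+ j)) (rdegree S))`_i).
  by split=> //; exact: CHS.
split; first split.
- move=> k x y; apply: F_inj; rewrite rmorphD rmorphM /= !tRE rmorphD iotaZ.
  exact: tS_lin.
- by move=> a b; rewrite mulr_algl mulr_algr.
- by move=> a b; apply: F_inj; rewrite !tRE !rmorphM tSC.
- move=> a b; apply: F_inj.
  by rewrite mulr_algl tRE iotaZ tRE -mulr_algl tSM rmorphM /= !tRE.
- by apply: F_inj; rewrite tRE rmorph1 tS1 rmorph_nat.
move=> a; pose x i := (ncoefs (fun j => (tR (a ^+ j))%:F) (rdegree S))`_i.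
have xE i : x i = (ncoefs (fun j => reduced_trace (iota a ^+ j)) (rdegree S))`_i.
  by congr nth; apply: eq_ncoefs => j; rewrite tRE rmorphXn.
(* The coefficients of chi beyond i = n are not at hand, so the condition is guarded by
   [i <= rdegree S]; being boolean and satisfiable for all i, it allows [xchoose]. *)
have exc i : exists c : A, (i <= rdegree S)%N ==> (c%:F == x i).
  case: leqP => [lei|]; last by exists 0.
  have [c Dc] := coef_in_A a _ _ (chiS (iota a) i lei).
  by exists c; rewrite /= xE Dc eqxx.
pose c i := xchoose (exc i).
have cE i : (i <= rdegree S)%N -> (c i)%:F = x i.
  by move=> lei; have /implyP/(_ lei)/eqP := xchooseP (exc i).
exists c; split=> [i /andP[_ /cE] //|].
(* The identity in R is the one for iota a in S, pulled back along the injection. *)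
apply: iota_inj; rewrite rmorph0 rmorphD rmorphXn rmorph_sum -[RHS](CHS (iota a)).
congr (_ + _); apply: eq_bigr => i _ /=.
by rewrite iotaZ rmorphXn cE // xE.
Qed.
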